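(* Let $m\ge1$ be a natural number, $n=2m+3$, $F=\mathbb{Z}^{2m}$, $G=\mathbb{Z}^3$, $\mathcal{A}=\operatorname{Sym}_{\mathbb{Z}}(\bigwedge^2F\oplus F\otimes G)\cong\mathbb{Z}[c_{ij},u_{ki}]$, and let $\mathcal{I}_n\subset\mathcal{A}$ be the ideal $$\mathcal{I}_n=(C^m,\ C^{m-1}\wedge u_1\wedge u_2,\ C^{m-1}\wedge u_1\wedge u_3,\ C^{m-1}\wedge u_2\wedge u_3)$$ (see context). The minimal graded free resolution of the cyclic $\mathcal{A}$-module $\mathcal{A}/\mathcal{I}_n$ is $$\begin{aligned}\mathcal{F}_\bullet:\ 0&\longrightarrow F\otimes(\textstyle\bigwedge^{2m}F)^{\otimes2}\otimes\bigwedge^3G\otimes\mathcal{A}(-2m+1,-3)\\ &\xrightarrow{\partial_3}(\textstyle\bigwedge^{2m}F)^{\otimes2}\otimes\bigwedge^2G\otimes\mathcal{A}(-2m+1,-2)\ \oplus\ \bigwedge^{2m}F\otimes\bigwedge^{2m-1}F\otimes\bigwedge^3G\otimes\mathcal{A}(-2m+2,-3)\\ &\xrightarrow{\partial_2}\textstyle\bigwedge^{2m}F\otimes\mathcal{A}(-m,0)\ \oplus\ \bigwedge^{2m}F\otimes\bigwedge^2G\otimes\mathcal{A}(-m+1,-2)\xrightarrow{\partial_1}\mathcal{A},\end{aligned}$$ with differentials $\partial_3,\partial_2,\partial_1$ as described in the context. For every field $k$ the resolution $\mathcal{F}_\bullet\otimes_{\mathbb{Z}}k$ is minimal over $$\mathcal{A}_k=\operatorname{Sym}_k(\textstyle\bigwedge^2\overline{F}\oplus\overline{F}\otimes\overline{G})\cong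 k[c_{ij},u_{ki}],\qquad \overline F=F\otimes_{\mathbb{Z}}k,\ \overline G=G\otimes_{\mathbb{Z}}k.$$ The ideal $\mathcal{I}_n\otimes_{\mathbb{Z}}k$ is thus perfect of grade three.
   Context: Here $\{g_1,\dots,g_{2m}\}$ is a basis of $F$, $A=(c_{ij})$ is the generic $2m\times2m$ skew symmetric matrix, $B=(u_{ki})$ the generic $3\times2m$ matrix, $C=\sum_{i<j}c_{ij}g_i\wedge g_j$, $u_k=\sum_{i=1}^{2m}u_{ki}g_i$, and $$C^j=\sum_{1\le i_1<\cdots<i_{2j}\le2m}\operatorname{Pf}_{i_1\ldots i_{2j}}(A)\,g_{i_1}\wedge\cdots\wedge g_{i_{2j}}\in\textstyle\bigwedge^{2j}F\otimes\mathcal{A},\qquad C^0=1,$$ with $\operatorname{Pf}_{i_1\ldots i_{2j}}(A)$ the Pfaffian of the submatrix on rows and columns $i_1,\dots,i_{2j}$. Elements of $\bigwedge^{2m}F\otimes\mathcal{A}$ are identified with elements of $\mathcal{A}$ via $g_1\wedge\cdots\wedge g_{2m}$. The bigrading is $|c_{ij}|=(1,0)$, $|u_{ki}|=(0,1)$, and $\mathcal{A}(-a,-b)$ is the free module with generator in bidegree $(a,b)$. Differentials: let $U$ be the $n\times n$ skew symmetric block matrix $\left(\begin{array}{c|c}O&B\\ \hline -B^T&A\end{array}\right)$ with $O$ the $3\times3$ zero block, and let $\operatorname{pf}(\overline{i_1\ldots i_k})$ be the Pfaffian of the matrix obtained from $U$ by deleting rows and columns $i_1,\dots,i_k$. In suitable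 bases of the free modules, $$\partial_3=\left(\begin{array}{c}B\\ \hline A\end{array}\right),\qquad \partial_1=\begin{pmatrix}-\operatorname{pf}(\overline1)&\operatorname{pf}(\overline2)&-\operatorname{pf}(\overline3)&\operatorname{pf}(\overline{123})\end{pmatrix},$$ $$\partial_2=\begin{pmatrix}\operatorname{pf}(\overline{123})&0&0&-\operatorname{pf}(\overline{234})&\operatorname{pf}(\overline{235})&\cdots&\operatorname{pf}(\overline{23n})\\0&\operatorname{pf}(\overline{123})&0&-\operatorname{pf}(\overline{134})&\operatorname{pf}(\overline{135})&\cdots&\operatorname{pf}(\overline{13n})\\0&0&\operatorname{pf}(\overline{123})&-\operatorname{pf}(\overline{124})&\operatorname{pf}(\overline{125})&\cdots&\operatorname{pf}(\overline{12n})\\ \operatorname{pf}(\overline1)&-\operatorname{pf}(\overline2)&\operatorname{pf}(\overline3)&-\operatorname{pf}(\overline4)&\operatorname{pf}(\overline5)&\cdots&\operatorname{pf}(\overline n)\end{pmatrix},$$ where the last basis element of the rank-$4$ module spans the summand $\bigwedge^{2m}F\otimes\mathcal{A}(-m,0)$, the first three span the other summand; and the first three basis elements of the rank-$n$ module span the summand with $\bigwedge^2G$, the last $2m$ the summand with $\bigwedge^{2m-1}F$. *)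

(* Defs.v *)
From HB Require Import structures.
From mathcomp Require Import all_boot all_order all_fingroup all_algebra.
From mathcomp Require Import ring_quotient generic_quotient.
From mathcomp Require Import boolp.
From mathcomp Require Import mpoly.

Set Implicit Arguments.
Unset Strict Implicit.
Unset Printing Implicit Defensive.

Import GRing.Theory.
Local Open Scope ring_scope.

Definition in_ideal (R : comNzRingType) (s : seq R) (x : R) : Prop :=
  exists a : 'I_(size s) -> R, x = \sum_(i < size s) a i * s`_i.

Definition ideal_pred (R : comNzRingType) (s : seq R) : {pred R} :=
  fun x => `[< in_ideal s x >].

Lemma ideal_predMl (R : comNzRingType) (s : seq R) (a x : R) :
  x \in ideal_pred s -> a * x \in ideal_pred s.
Proof.
move=> /asboolP[b ->]; apply/asboolP; exists (fun i => a * b i).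
by rewrite mulr_sumr; apply: eq_bigr => i _; rewrite mulrA.
Qed.

Lemma ideal_pred_zmod_closed (R : comNzRingType) (s : seq R) :
  zmod_closed (ideal_pred s).
Proof.
split=> [|x y /asboolP[a ->] /asboolP[b ->]]; apply/asboolP.
  by exists (fun=> 0); rewrite big1 // => i _; rewrite mul0r.
exists (fun i => a i - b i); rewrite -sumrB.
by apply: eq_bigr => i _; rewrite mulrBl.
Qed.

HB.instance Definition _ (R : comNzRingType) (s : seq R) :=
  GRing.isZmodClosed.Build R (ideal_pred s) (ideal_pred_zmod_closed s).

(* The R-module R / (s).  The ideal is not required to be proper, so this is
   only a module, and the [idealr] interface (proper ideals) is not used. *)
Definition cyclic_module (R : comNzRingType) (s : seq R) : Type :=
  {ideal_quot (ideal_pred s : zmodClosed R)}.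

HB.instance Definition _ (R : comNzRingType) (s : seq R) :=
  GRing.Zmodule.on (cyclic_module s).

Section CyclicModule.
Variables (R : comNzRingType) (s : seq R).
Local Open Scope quotient_scope.

Definition cyclic_proj (x : R) : cyclic_module s :=
  \pi_({ideal_quot (ideal_pred s : zmodClosed R)}) x.

Definition cyclic_scale (a : R) (q : cyclic_module s) : cyclic_module s :=
  cyclic_proj (a * repr (q : {ideal_quot (ideal_pred s : zmodClosed R)})).

Lemma cyclic_projP (x y : R) :
  reflect (cyclic_proj x = cyclic_proj y) (x - y \in ideal_pred s).
Proof. by rewrite Quotient.idealrBE; apply: eqP. Qed.

Lemma cyclic_projK (q : cyclic_module s) :
  cyclic_proj (repr (q : {ideal_quot (ideal_pred s : zmodClosed R)})) = q.
Proof. exact: reprK. Qed.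

Lemma cyclic_projD : {morph cyclic_proj : x y / x + y}.
Proof. exact: pi_addr. Qed.

Lemma cyclic_scaleE (a x : R) :
  cyclic_scale a (cyclic_proj x) = cyclic_proj (a * x).
Proof.
apply/cyclic_projP; rewrite -mulrBr; apply/ideal_predMl/cyclic_projP.
exact: cyclic_projK.
Qed.

Fact cyclic_scaleA a b v :
  cyclic_scale a (cyclic_scale b v) = cyclic_scale (a * b) v.
Proof. by rewrite -(cyclic_projK v) !cyclic_scaleE mulrA. Qed.

Fact cyclic_scale1 : left_id 1 cyclic_scale.
Proof. by move=> v; rewrite -(cyclic_projK v) cyclic_scaleE mul1r. Qed.

Fact cyclic_scaleDr : right_distributive cyclic_scale +%R.
Proof.
move=> a u v; rewrite -(cyclic_projK u) -(cyclic_projK v).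
by rewrite -cyclic_projD !cyclic_scaleE -cyclic_projD mulrDr.
Qed.

Fact cyclic_scaleDl v : {morph cyclic_scale^~ v : a b / a + b}.
Proof.
move=> a b; rewrite -(cyclic_projK v).
by rewrite !cyclic_scaleE -cyclic_projD mulrDl.
Qed.

HB.instance Definition _ := GRing.Zmodule_isLmodule.Build R (cyclic_module s)
  cyclic_scaleA cyclic_scale1 cyclic_scaleDr cyclic_scaleDl.

End CyclicModule.

Definition projective_module (R : comNzRingType) (P : lmodType R) : Prop :=
  forall (M N : lmodType R) (f : {linear M -> N}) (g : {linear P -> N}),
    (forall y, exists x, f x = y) ->
    exists h : {linear P -> M}, forall x, f (h x) = g x.

(* Exactness of a projective resolution 0 -> P_d -> ... -> P_0 -> M -> 0. *)
Definition projective_dimension_le (R : comNzRingType) (M : lmodType R)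
    (d : nat) : Prop :=
  exists (P : nat -> lmodType R) (f : forall i, {linear P i.+1 -> P i})
         (e : {linear P 0 -> M}),
    [/\ forall i, projective_module (P i),
        forall i, (d < i)%N -> forall x : P i, x = 0,
        forall y, exists x, e x = y,
        forall x, e x = 0 <-> exists y, x = f 0 y
      & forall i x, f i x = 0 <-> exists y, x = f i.+1 y].

Definition projective_dimension (R : comNzRingType) (M : lmodType R)
    (d : nat) : Prop :=
  projective_dimension_le M d /\
  forall d', projective_dimension_le M d' -> (d <= d')%N.

Definition regular_sequence (R : comNzRingType) (s : seq R) : Prop :=
  (forall i, (i < size s)%N -> forall x,
     in_ideal (take i s) (s`_i * x) -> in_ideal (take i s) x) /\
  ~ in_ideal s 1.

Definition regular_sequence_in (R : comNzRingType) (I s : seq R) : Prop :=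
  (forall x, x \in s -> in_ideal I x) /\ regular_sequence s.

Definition grade (R : comNzRingType) (I : seq R) (d : nat) : Prop :=
  (exists s, regular_sequence_in I s /\ size s = d) /\
  forall s, regular_sequence_in I s -> (size s <= d)%N.

Definition perfect_of_grade (R : comNzRingType) (I : seq R) (d : nat) : Prop :=
  grade I d /\ projective_dimension (cyclic_module I : lmodType R) d.

(* Sum over the perfect matchings {s 0, s 1}, {s 2, s 3}, ... of 'I_n, each
   represented by the permutation s with s 0 < s 1, s 2 < s 3, ... and
   s 0 < s 2 < s 4 < ...; the value is 0 when n is odd and 1 when n = 0. *)
Definition matching_perm (n : nat) (s : 'S_n) : bool :=
  [&& ~~ odd n,
      [forall i : 'I_n, forall j : 'I_n,
         (~~ odd i && (j == i.+1 :> nat)) ==> (s i < s j)%N]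
    & [forall i : 'I_n, forall j : 'I_n,
         (~~ odd i && (j == i.+2 :> nat)) ==> (s i < s j)%N]].

Definition Pf (R : comNzRingType) (n : nat) (A : 'M[R]_n) : R :=
  \sum_(s : 'S_n | matching_perm s)
    (-1) ^+ s *
    \prod_(i < n) \prod_(j < n | ~~ odd i && (j == i.+1 :> nat)) A (s i) (s j).

(* Pfaffian of the submatrix on the rows and columns in S; [enum_val] lists
   the elements of S in increasing order. *)
Definition Pf_on (R : comNzRingType) (n : nat) (A : 'M[R]_n)
    (S : {set 'I_n}) : R :=
  Pf (mxsub (fun i : 'I_#|S| => enum_val i) (fun i : 'I_#|S| => enum_val i) A).

(* Rows and columns are deleted by their 1-based numbers. *)
Definition Pf_del (R : comNzRingType) (n : nat) (A : 'M[R]_n)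
    (l : seq nat) : R :=
  Pf_on A [set i : 'I_n | i.+1 \notin l].

(* x : ext R N stands for \sum_S x S g_S, where g_S = g_{i_1} /\ ... /\ g_{i_j}
   for S = {i_1 < ... < i_j}. *)
Definition ext (R : comNzRingType) (N : nat) : Type := {ffun {set 'I_N} -> R}.

(* g_S /\ g_T = (-1)^(inversions S T) g_(S :|: T) for disjoint S and T. *)
Definition inversions (N : nat) (S T : {set 'I_N}) : nat :=
  #|[set p : 'I_N * 'I_N | [&& p.1 \in S, p.2 \in T & (p.2 < p.1)%N]]|.

Definition wedge (R : comNzRingType) (N : nat) (x y : ext R N) : ext R N :=
  [ffun S : {set 'I_N} => \sum_(T : {set 'I_N} | T \subset S)
     (-1) ^+ inversions T (S :\: T) * x T * y (S :\: T)].

(* C^j, given by its Pfaffian formula: this is the j-th divided power of C, not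
   its j-fold wedge product. *)
Definition ext_C (R : comNzRingType) (N : nat) (A : 'M[R]_N) (j : nat) :
    ext R N :=
  [ffun S : {set 'I_N} => if #|S| == (2 * j)%N then Pf_on A S else 0].

(* u_k = \sum_i B k i g_i *)
Definition ext_u (R : comNzRingType) (N : nat) (B : 'M[R]_(3, N)) (k : 'I_3) :
    ext R N :=
  [ffun S : {set 'I_N} => \sum_(i < N | S == [set i]) B k i].

(* The identification of the top exterior power with the ring of scalars. *)
Definition ext_top (R : comNzRingType) (N : nat) (x : ext R N) : R :=
  x [set: 'I_N].

Definition cvar (m : nat) : finType :=
  {p : 'I_(2 * m) * 'I_(2 * m) | (p.1 < p.2)%N}.
Definition uvar (m : nat) : finType := ('I_3 * 'I_(2 * m))%type.
Definition var (m : nat) : finType := (cvar m + uvar m)%type.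

(* K[c_ij, u_ki] *)
Definition gring (K : comNzRingType) (m : nat) : comNzRingType :=
  {mpoly K[#|var m|]}.

Definition gvar (K : comNzRingType) (m : nat) (v : var m) : gring K m :=
  'X_(enum_rank v).

Definition generic_A (K : comNzRingType) (m : nat) : 'M[gring K m]_(2 * m) :=
  \matrix_(i, j)
    if insub (i, j) is Some p then gvar K (inl p : var m)
    else if insub (j, i) is Some p then - gvar K (inl p : var m)
    else 0.

Definition generic_B (K : comNzRingType) (m : nat) : 'M[gring K m]_(3, 2 * m) :=
  \matrix_(k, i) gvar K (inr (k, i) : var m).

Definition ideal_gens (m : nat) : seq (gring int m) :=
  let C := ext_C (generic_A int m) in
  let u (k : nat) := ext_u (generic_B int m) (inord k.-1) in
  [seq ext_top x | x <- [:: C m;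
                            wedge (wedge (C m.-1) (u 1)) (u 2);
                            wedge (wedge (C m.-1) (u 1)) (u 3);
                            wedge (wedge (C m.-1) (u 2)) (u 3)]].

Definition generic_U (m : nat) : 'M[gring int m]_(3 + 2 * m) :=
  block_mx 0 (generic_B int m) (- (generic_B int m)^T) (generic_A int m).

Definition diff3 (m : nat) : 'M[gring int m]_(3 + 2 * m, 2 * m) :=
  col_mx (generic_B int m) (generic_A int m).

(* Column j of the right-hand blocks carries the 1-based label j + 4. *)
Definition diff2 (m : nat) : 'M[gring int m]_(3 + 1, 3 + 2 * m) :=
  let pf := Pf_del (generic_U m) in
  block_mx
    (pf [:: 1; 2; 3]%N)%:M
    (\matrix_(i < 3, j < 2 * m)
       ((-1) ^+ j.+1 * pf (rcons (rem i.+1 [:: 1; 2; 3]%N) (j + 4)%N)))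
    (\row_(i < 3) ((-1) ^+ i * pf [:: i.+1]%N))
    (\row_(j < 2 * m) ((-1) ^+ j.+1 * pf [:: j + 4]%N)).

Definition diff1 (m : nat) : 'M[gring int m]_(1, 3 + 1) :=
  let pf := Pf_del (generic_U m) in
  \row_(i < 3 + 1)
    [:: - pf [:: 1]%N; pf [:: 2]%N; - pf [:: 3]%N; pf [:: 1; 2; 3]%N]`_i.

Definition base_change (K : comNzRingType) (m : nat) (x : gring int m) :
    gring K m :=
  map_mpoly (intr : int -> K) x.

Definition bideg_mon (m : nat) (x : 'X_{1..#|var m|}) : int * int :=
  ((\sum_(v : cvar m) x (enum_rank (inl v : var m)))%N%:Z,
   (\sum_(v : uvar m) x (enum_rank (inr v : var m)))%N%:Z).

Definition bihomogeneous (K : comNzRingType) (m : nat) (d : int * int)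
    (f : gring K m) : Prop :=
  forall x, x \in msupp f -> bideg_mon x = d.

(* A bigraded free module given by a homogeneous basis. *)
Record gfree := GFree { gbasis : finType; gdeg : gbasis -> int * int }.

(* L (x) A(a, b), for L a free Z-module with basis T. *)
Definition gtwist (T : finType) (a b : int) : gfree :=
  @GFree T (fun=> (- a, - b)).

Definition gdsum (M N : gfree) : gfree :=
  @GFree (gbasis M + gbasis N)%type
    (fun t => match t with inl x => gdeg x | inr y => gdeg y end).

(* Basis of the j-th exterior power of Z^N. *)
Definition ext_basis (N j : nat) : finType := {S : {set 'I_N} | #|S| == j}.

Definition free0 : gfree := gtwist unit 0 0.

Definition free1 (m : nat) : gfree :=
  let N := (2 * m)%N in
  gdsum (gtwist (ext_basis N N) (- m%:Z) 0)
        (gtwist (ext_basis N N * ext_basis 3 2)%type (- m%:Z + 1) (- 2)).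

Definition free2 (m : nat) : gfree :=
  let N := (2 * m)%N in
  gdsum
    (gtwist ((ext_basis N N * ext_basis N N) * ext_basis 3 2)%type
            (- N%:Z + 1) (- 2))
    (gtwist (ext_basis N N * ext_basis N N.-1 * ext_basis 3 3)%type
            (- N%:Z + 2) (- 3)).

Definition free3 (m : nat) : gfree :=
  let N := (2 * m)%N in
  gtwist ('I_N * (ext_basis N N * ext_basis N N) * ext_basis 3 3)%type
         (- N%:Z + 1) (- 3).

(* The matrix d, in the bases e of M and f of N, of a map of bidegree (0, 0)
   from N to M (matrices act on column vectors). *)
Definition graded_map (K : comNzRingType) (m p q : nat) (M N : gfree)
    (e : 'I_p -> gbasis M) (f : 'I_q -> gbasis N)
    (d : 'M[gring K m]_(p, q)) : Prop :=
  forall i j, bihomogeneous (gdeg (f j) - gdeg (e i)) (d i j).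

Definition exact_at (R : comNzRingType) (p q r : nat)
    (d : 'M[R]_(p, q)) (d' : 'M[R]_(q, r)) : Prop :=
  forall v : 'cV[R]_q, d *m v = 0 <-> exists w : 'cV[R]_r, v = d' *m w.

(* 0 -> R^r3 -> R^r2 -> R^r1 -> R -> R/(I) -> 0 is exact. *)
Definition free_resolution (R : comNzRingType) (I : seq R) (r1 r2 r3 : nat)
    (d1 : 'M[R]_(1, r1)) (d2 : 'M[R]_(r1, r2)) (d3 : 'M[R]_(r2, r3)) : Prop :=
  [/\ forall x : R, cyclic_proj I x = 0 <-> exists v : 'cV[R]_r1, x%:M = d1 *m v,
      exact_at d1 d2, exact_at d2 d3
    & forall v : 'cV[R]_r3, d3 *m v = 0 -> v = 0].

(* The image of d lies in A_+ times the target, A_+ = (c_ij, u_ki). *)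
Definition minimal_map (K : comNzRingType) (m p q : nat)
    (d : 'M[gring K m]_(p, q)) : Prop :=
  forall i j, in_ideal [seq gvar K v | v <- enum (var m)] (d i j).

Definition minimal_graded_free_resolution (K : comNzRingType) (m : nat)
    (I : seq (gring K m)) (r1 r2 r3 : nat) (M0 M1 M2 M3 : gfree)
    (e0 : 'I_1 -> gbasis M0) (e1 : 'I_r1 -> gbasis M1)
    (e2 : 'I_r2 -> gbasis M2) (e3 : 'I_r3 -> gbasis M3)
    (d1 : 'M[gring K m]_(1, r1)) (d2 : 'M[gring K m]_(r1, r2))
    (d3 : 'M[gring K m]_(r2, r3)) : Prop :=
  [/\ [/\ bijective e0, bijective e1, bijective e2 & bijective e3],
      [/\ graded_map e0 e1 d1, graded_map e1 e2 d2 & graded_map e2 e3 d3],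
      free_resolution I d1 d2 d3
    & [/\ minimal_map d1, minimal_map d2 & minimal_map d3]].

(* Main.v *)
From HB Require Import structures.
From mathcomp Require Import all_boot all_order all_fingroup all_algebra.
From mathcomp Require Import boolp.
From mathcomp Require Import zify ring.
From mathcomp Require Import mpoly.
Require Import Defs.

Set Implicit Arguments.
Unset Strict Implicit.
Unset Printing Implicit Defensive.

Import GRing.Theory.
Local Open Scope ring_scope.

(** The complex is exact because its homology is killed by a regular sequence of
    length three, and every regular element used kills homology through an
    explicit homotopy.

    Pfaffians are handled as functions of words of row labels.  Expansion along
    the first letter is a contraction, contractions anticommute, and so the
    Pfaffian of a word is alternating ([alternating_pfw]); it agrees with the sum
    over perfect matchings ([Pf_pfw]).  All identities between Pfaffians that
    are needed then follow by expanding a word with a repeated letter.  In block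
    form they say that [d2 * d3 = 0], that multiplication by Pf(A) is
    null-homotopic ([null_homotopic_pfA]), and that multiplication by each
    Pfaffian with one border vertex deleted is null-homotopic
    ([null_homotopic_pair]).  The remaining relation [d1 * d2 = 0] follows since
    Pf(A) is a nonzerodivisor ([mul_d1_d2]).

    For regularity ([regular_triple]) the vertices are ordered as
    1', 1 .. m, 2', m+1 .. 2m, 3'.  For a weight concave in the position sum of
    an edge, the leading terms of Pf(A) and of the Pfaffians with 3' or 1' deleted
    are the products along three consecutive antidiagonals, hence coprime
    monomials ([pfg_leads]).  Elements with coprime leading monomials form a
    regular sequence, by a triangular change of basis that carries
    multiplication by the monomials to multiplication by the elements
    ([leads_regular]).  The leading coefficients are signs, so the argument works
    over the integers and over every field at once.  A regular sequence of
    length three that acts by null-homotopies makes the complex exact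
    ([acyclic_exact1], [acyclic_exact2]).

    The bidegrees of the entries never vanish, so the resolution is minimal
    ([graded_minimal]), and in particular d3 has no left inverse.  This gives the
    upper bound for the grade, as four regular elements in the ideal would
    force the dual of d3 to be onto ([regular_sequence_size]), and the lower bound
    for the projective dimension, as a shorter projective resolution would
    give a left inverse by comparison ([resolution_projective_dimension_ge]).

    Finally the exterior generators are Pfaffians up to sign
    ([ext_top_C_u_u]), because wedging with a vector is again a contraction. *)

(** * Contractions of alternating functions and Pfaffians of words *)

Section Contraction.
Variables (R : comNzRingType) (T : Type).
Implicit Types (g h : T -> R) (f : seq T -> R) (s t p q : seq T).

(** The interior product: it sums [± g x * f (s minus x)] over the letters x of
    the word s, the sign being the parity of the position of x.  Recursing on
    the word, rather than summing over positions, is what keeps the proofs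
    below free of index shifts. *)
Fixpoint contract g f s : R :=
  if s is x :: t then g x * f t - contract g (fun u => f (x :: u)) t else 0.

Lemma eq_contract_size g f f' s :
  (forall t, (size t).+1 = size s -> f t = f' t) ->
  contract g f s = contract g f' s.
Proof.
elim: s f f' => //= x t IH f f' ff'; rewrite ff' //; congr (_ - _).
by apply: IH => u ut; apply: ff'; rewrite /= ut.
Qed.

Lemma eq_contract g f f' s : f =1 f' -> contract g f s = contract g f' s.
Proof. by move=> ff'; apply: eq_contract_size => t _. Qed.

Lemma contractZB g f f' b s :
  contract g (fun u => b * f u - f' u) s = b * contract g f s - contract g f' s.
Proof.
elim: s f f' => /= [|x t IH] f f'; first by rewrite mulr0 subr0.
by rewrite IH; ring.
Qed.

Lemma contract0 g f s : f =1 (fun=> 0) -> contract g f s = 0.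
Proof.
by elim: s f => //= x t IH f f0; rewrite f0 IH ?mulr0 ?subr0 // => u; apply: f0.
Qed.

(** Contractions anticommute.  In the recursion the two terms where g or h eats
    the first letter cancel against those of the swapped product. *)
Lemma contractC g h f s :
  contract g (contract h f) s = - contract h (contract g f) s.
Proof.
elim: s f => /= [|x t IH] f; first by rewrite oppr0.
by rewrite !contractZB IH; ring.
Qed.

(** Stated apart from anticommutation because 2 may vanish in the ring. *)
Lemma contract_contract g f s : contract g (contract g f) s = 0.
Proof.
by elim: s f => //= x t IH f; rewrite contractZB IH; ring.
Qed.

Lemma contract_cat g f s t :
  contract g f (s ++ t) =
  contract g (fun u => f (u ++ t)) s
  + (-1) ^+ size s * contract g (fun u => f (s ++ u)) t.
Proof.
elim: s f => /= [|x s IH] f; first by rewrite add0r mul1r.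
by rewrite IH exprS; ring.
Qed.

Lemma contract_all0 g f s : all (fun x => g x == 0) s -> contract g f s = 0.
Proof.
elim: s f => //= x s IH f /andP[/eqP-> gs].
by rewrite IH // mul0r subr0.
Qed.

Lemma contract_closed (P : R -> Prop) g f s :
    P 0 -> (forall x y, P x -> P y -> P (x - y)) ->
    (forall l w r, s = l ++ w :: r -> P (g w * f (l ++ r))) ->
  P (contract g f s).
Proof.
move=> P0 PB; elim: s f => //= x s IH f Pf; apply: PB; first exact: (Pf [::]).
by apply: IH => l w r def_s; apply: (Pf (x :: l)); rewrite def_s.
Qed.

(** Both clauses are kept for the same reason: a sign change under adjacent
    swaps does not give vanishing on repeated letters in characteristic 2. *)
Definition alternating f :=
  (forall p x y q, f (p ++ [:: x, y & q]) = - f (p ++ [:: y, x & q])) /\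
  (forall p x q, f (p ++ [:: x, x & q]) = 0).

Lemma alternating_cons f x : alternating f -> alternating (fun u => f (x :: u)).
Proof.
by case=> fC f0; split=> [p y z q|p y q]; [apply: (fC (x :: p)) | apply: (f0 (x :: p))].
Qed.

(** A swap exchanges the two terms that remove one of the swapped letters, and
    commutes with every other term. *)
Lemma alternating_contract g f : alternating f -> alternating (contract g f).
Proof.
move=> altf; split.
  move=> p x y q; elim: p f altf => [|z p IH] f altf /=.
    have f2 : contract g (fun u => f [:: x, y & u]) q
            = - contract g (fun u => f [:: y, x & u]) q.
      rewrite -[RHS]add0r -(mul0r (contract g (fun u => f [:: x, y & u]) q)).
      rewrite -contractZB; apply: eq_contract => u.
      by rewrite mul0r add0r; apply: (altf.1 [::]).
    by rewrite f2; ring.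
  rewrite (IH _ (alternating_cons z altf)) (altf.1 p x y q).
  by ring.
move=> p x q; elim: p f altf => [|z p IH] f altf /=.
  by rewrite (contract0 g (f := fun u => _)) => [|u]; [ring | apply: (altf.2 [::])].
by rewrite (altf.2 p) (IH _ (alternating_cons z altf)); ring.
Qed.

Lemma alternating_move f p x q r :
  alternating f -> f (p ++ x :: q ++ r) = (-1) ^+ size q * f (p ++ q ++ x :: r).
Proof.
move=> altf; elim: q p => [|y q IH] p /=; first by rewrite mul1r.
by rewrite altf.1 -cat_rcons IH cat_rcons exprS; ring.
Qed.

Lemma alternating_repeat f x p q : alternating f -> f (x :: p ++ x :: q) = 0.
Proof.
move=> altf; rewrite (alternating_move [::] _ _ _ altf) /= (altf.2 p).
by rewrite mulr0.
Qed.

End Contraction.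

Lemma contract_map (R : comNzRingType) (T U : Type) (h : U -> T) g (f : seq T -> R) s :
  contract g f (map h s) = contract (g \o h) (fun u => f (map h u)) s.
Proof. by elim: s f => //= x s IH f; rewrite IH. Qed.

Lemma contract_uniq (R : comNzRingType) (T : eqType) g (f : seq T -> R) s :
  uniq s ->
  contract g f s = \sum_(x <- s) (-1) ^+ index x s * g x * f (rem x s).
Proof.
elim: s f => [|x s IH] f /=; first by rewrite big_nil.
case/andP=> xs us; rewrite big_cons /= !eqxx mul1r IH //.
congr (_ + _); rewrite -sumrN [LHS]big_seq_cond [RHS]big_seq_cond.
apply: eq_bigr => y /andP[ys _].
have /negPf xy: x != y by apply: contraNneq xs => ->.
by rewrite xy exprS; ring.
Qed.

Section PfaffianWord.
Variables (R : comNzRingType) (T : Type) (a : T -> T -> R).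

(** The Pfaffian of a word of row labels, by expansion along its first letter;
    n is fuel.  Words may have repeated or unsorted letters, so that moving a row
    or expanding along a foreign row are ordinary operations on words. *)
Fixpoint pfw_rec (n : nat) (s : seq T) : R :=
  match n, s with
  | _, [::] => 1
  | n'.+1, x :: t => contract (a x) (pfw_rec n') t
  | 0, _ => 0
  end.

Definition pfw (s : seq T) : R := pfw_rec (size s) s.

Lemma pfw_rec_size n s : (size s <= n)%N -> pfw_rec n s = pfw s.
Proof.
rewrite /pfw; elim: n {-2}n (leqnn n) s => [|k IH] [|n] // nk [|x t] //= tn.
apply: eq_contract_size => u su.
have un : (size u <= n)%N by lia.
have ut : (size u <= size t)%N by lia.
by rewrite IH // [RHS]IH //; lia.
Qed.

Lemma pfw_nil : pfw [::] = 1. Proof. by []. Qed.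

Lemma pfw_cons x t : pfw (x :: t) = contract (a x) pfw t.
Proof.
apply: eq_contract_size => u su.
by apply: (@pfw_rec_size (size t)); rewrite -su.
Qed.

Hypothesis aN : forall x y, a x y = - a y x.
Hypothesis a0 : forall x, a x x = 0.

(** Swapping the first two letters is anticommutation of the two contractions
    they stand for; a swap further right is left to [alternating_contract]. *)
Lemma alternating_pfw_rec n : alternating (pfw_rec n).
Proof.
elim: n => [|n IH]; first by split=> [[|z p] x y q|[|z p] x q] /=; rewrite ?oppr0.
have head x y q : pfw_rec n.+1 [:: x, y & q] = a x y * pfw_rec n q
     - contract (a x) (contract (a y) (pfw_rec n.-1)) q *+ (0 < n)%N.
  rewrite /=; congr (_ - _); case: n {IH} => [|n] /=; last by rewrite mulr1n.
  by rewrite mulr0n contract0.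
split=> [[|z p] x y q|[|z p] x q].
- by rewrite !head contractC aN; case: n {IH head} => [|n] /=; rewrite ?mulr0n ?mulr1n; ring.
- exact: (alternating_contract (a z) IH).1.
- by rewrite head a0 contract_contract mul0rn; ring.
- exact: (alternating_contract (a z) IH).2.
Qed.

Lemma alternating_pfw : alternating pfw.
Proof.
split=> [p x y q|p x q]; rewrite /pfw.
  have -> : size (p ++ [:: y, x & q]) = size (p ++ [:: x, y & q]) by rewrite !size_cat.
  exact: (alternating_pfw_rec _).1.
exact: (alternating_pfw_rec _).2.
Qed.

End PfaffianWord.

Lemma pfw_map (R : comNzRingType) (T U : Type) (h : U -> T) (a : T -> T -> R) s :
  pfw a (map h s) = pfw (fun x y => a (h x) (h y)) s.
Proof.
rewrite /pfw size_map; move: (size s) => n; elim: n s => [|n IH] [|x s] //=.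
by rewrite contract_map; apply: eq_contract => u; apply: IH.
Qed.

Lemma eq_pfw (R : comNzRingType) (T : Type) (a b : T -> T -> R) s :
  (forall x y, a x y = b x y) -> pfw a s = pfw b s.
Proof. by move=> ab; congr (pfw _ s); apply: funext => x; apply: funext => y. Qed.

(** A Pfaffian inherits any multiplicative grading or filtration in which the
    entry at (x, y) has degree [w x + w y], because every matching of the word
    uses each letter once. *)
Lemma pfw_closed (R : comNzRingType) (T : eqType) (a : T -> T -> R)
    (P : nat -> R -> Prop) (w : T -> nat) s :
    (forall d, P d 0) -> (forall d x y, P d x -> P d y -> P d (x - y)) ->
    (forall d e x y, P d x -> P e y -> P (d + e)%N (x * y)) -> P 0 1 ->
    {in s &, forall x y, P (w x + w y)%N (a x y)} ->
  P (\sum_(x <- s) w x)%N (pfw a s).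
Proof.
move=> P0 PB PM P1; move: {2}(size s) (leqnn (size s)) => n.
elim: n s => [|n IH] [|x s] //=; rewrite ?big_nil ?pfw_nil // big_cons => sn aP.
rewrite pfw_cons; apply: contract_closed => //; first exact: PB.
move=> l y r def_s.
have -> : (w x + \sum_(z <- s) w z = w x + w y + \sum_(z <- l ++ r) w z)%N.
  by rewrite def_s !big_cat big_cons /=; lia.
apply: PM; first by apply: aP; rewrite def_s !inE ?eqxx // mem_cat !inE eqxx !orbT.
have sub z : z \in l ++ r -> z \in x :: s.
  by rewrite def_s inE !mem_cat inE => /orP[] ->; rewrite ?orbT.
apply: IH => [|y1 y2 /sub y1s /sub y2s]; last exact: aP.
by move: sn; rewrite def_s !size_cat /=; lia.
Qed.

(** * The matching Pfaffian of a matrix is the Pfaffian of a word *)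

(** A permutation is an image j of i together with a permutation of what is
    left; the map is injective, and the cardinals agree. *)
Lemma sum_lift_perm (V : nmodType) n (i : 'I_n.+1) (F : 'S_n.+1 -> V) :
  \sum_(s : 'S_n.+1) F s = \sum_(j : 'I_n.+1) \sum_(t : 'S_n) F (lift_perm i j t).
Proof.
rewrite pair_bigA /=.
rewrite (reindex (fun p : 'I_n.+1 * 'S_n => lift_perm i p.1 p.2)) //=.
apply/onW_bij/inj_card_bij; last by rewrite card_prod card_ord !card_Sn factS.
move=> [j t] [j' t'] /= eqs.
have ej : j = j' by rewrite -(lift_perm_id i j t) eqs lift_perm_id.
rewrite -ej in eqs *; congr (_, _); apply/permP => k.
by apply: (lift_inj (h := j)); rewrite -!(lift_perm_lift i) eqs.
Qed.

Lemma matching_permP n (s : 'S_n) :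
  reflect [/\ ~~ odd n,
      forall i j : 'I_n, ~~ odd i -> j = i.+1 :> nat -> (s i < s j)%N
    & forall i j : 'I_n, ~~ odd i -> j = i.+2 :> nat -> (s i < s j)%N]
  (matching_perm s).
Proof.
apply: (iffP and3P) => [[on /forallP H1 /forallP H2]|[on H1 H2]]; split=> //.
- by move=> i j oi ij; move/forallP/(_ j)/implyP: (H1 i); apply; rewrite oi ij /=.
- by move=> i j oi ij; move/forallP/(_ j)/implyP: (H2 i); apply; rewrite oi ij /=.
- by apply/forallP=> i; apply/forallP=> j; apply/implyP => /andP[? /eqP]; apply: H1.
- by apply/forallP=> i; apply/forallP=> j; apply/implyP => /andP[? /eqP]; apply: H2.
Qed.

(** The even positions increase and each odd position exceeds its predecessor,
    so the value at 0 is the least one. *)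
Lemma matching_perm0 n (s : 'S_n.+1) : matching_perm s -> s ord0 = ord0.
Proof.
case/matching_permP=> on H1 H2.
have H k (lk : (k < n.+1)%N) : (s ord0 <= s (Ordinal lk))%N.
  elim: k {-2}k (leqnn k) lk => [|b IH] k.
    by case: k => // _ lk; rewrite (_ : Ordinal lk = ord0) //; apply: val_inj.
  case: k => [|k kb lk]; first by move=> _ lk; rewrite (_ : Ordinal lk = ord0) //; apply: val_inj.
  have lk' : (k < n.+1)%N by lia.
  have [ok|ek] := boolP (odd k); last first.
    by apply: leq_trans (IH k _ lk') (ltnW (H1 _ _ _ _)) => //; lia.
  case: k ok kb lk lk' => // k ok kb lk lk'.
  have lk2 : (k < n.+1)%N by lia.
  by apply: leq_trans (IH k _ lk2) (ltnW (H2 _ _ _ _)) => //=; lia.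
apply: val_inj; have := H _ (ltn_ord (s^-1 ord0)%g).
rewrite (_ : Ordinal _ = s^-1 ord0)%g ?permKV; last exact: val_inj.
by rewrite leqn0 => /eqP.
Qed.

(** The matching that joins 0 to j.+1 and follows t on the other points. *)
Definition lift_perm2 n (j : 'I_n.+1) (t : 'S_n) : 'S_n.+2 :=
  lift_perm ord0 ord0 (lift_perm ord0 j t).

Lemma matching_lift_perm2 n (j : 'I_n.+1) (t : 'S_n) :
  matching_perm (lift_perm2 j t) = matching_perm t.
Proof.
have s0 : lift_perm2 j t ord0 = ord0 by rewrite /lift_perm2 lift_perm_id.
have s1 : lift_perm2 j t (lift ord0 ord0) = lift ord0 j.
  by rewrite /lift_perm2 lift_perm_lift lift_perm_id.
have s2 k : lift_perm2 j t (lift ord0 (lift ord0 k)) = lift ord0 (lift j (t k)).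
  by rewrite /lift_perm2 !lift_perm_lift.
have s2lt k l : (lift_perm2 j t (lift ord0 (lift ord0 k)) <
     lift_perm2 j t (lift ord0 (lift ord0 l)))%N = (t k < t l)%N.
  by rewrite !s2 /= /bump; lia.
apply/matching_permP/matching_permP => -[on H1 H2]; split=> [|k l ok lk|k l ok lk].
- by move: on; rewrite /= negbK.
- by rewrite -s2lt; apply: H1; rewrite /= /bump /= ?lk //=; lia.
- by rewrite -s2lt; apply: H2; rewrite /= /bump /= ?lk //=; lia.
- by rewrite /= negbK.
- move: k l ok lk => k l.
  case: (unliftP ord0 k) => [k1|] ->; case: (unliftP ord0 l) => [l1|] -> //=; last first.
    rewrite /bump /= => _ [l10]; rewrite s0 (_ : l1 = ord0) ?s1 //; apply: val_inj.
    exact: l10.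
  case: (unliftP ord0 k1) => [k2|] -> //=; case: (unliftP ord0 l1) => [l2|] -> //=.
  by rewrite s2lt /bump /= !add1n /= negbK => o [] e; apply: H1.
- move: k l ok lk => k l.
  case: (unliftP ord0 k) => [k1|] ->; case: (unliftP ord0 l) => [l1|] -> //=; last first.
    case: (unliftP ord0 l1) => [l2|] -> //= _ _.
    by rewrite s0 s2 /=.
  case: (unliftP ord0 k1) => [k2|] -> //=; case: (unliftP ord0 l1) => [l2|] -> //=.
  by rewrite s2lt /bump /= !add1n /= negbK => o [] e; apply: H2.
Qed.

(** The vertex 0 is matched with some j.+1, and erasing that edge leaves a
    matching of the remaining vertices; the sign of the edge is [odd_lift_perm]. *)
Lemma Pf_expand (R : comNzRingType) n (A : 'M[R]_n.+2) :
  Pf A = \sum_(j : 'I_n.+1) (-1) ^+ j * A ord0 (lift ord0 j) *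
     Pf (mxsub (fun k => lift ord0 (lift j k)) (fun k => lift ord0 (lift j k)) A).
Proof.
rewrite /Pf big_mkcond (sum_lift_perm ord0) (bigD1 ord0) //=.
rewrite [X in _ + X]big1 ?addr0 => [|j0 j0n0]; last first.
  apply: big1 => t _; case: ifP => // /matching_perm0; rewrite lift_perm_id => e.
  by rewrite e eqxx in j0n0.
rewrite (sum_lift_perm ord0); apply: eq_bigr => j _.
rewrite -big_mkcond /= mulr_sumr; apply: eq_big => [t|t _].
  exact: matching_lift_perm2.
have -> : (-1) ^+ lift_perm ord0 ord0 (lift_perm ord0 j t) = (-1) ^+ j * (-1) ^+ t :> R.
  rewrite !odd_lift_perm /= -[in RHS](signr_odd _ j).
  by rewrite -signr_addb.
rewrite -!mulrA [in RHS](mulrCA (A _ _)); congr (_ * (_ * _)).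
rewrite 2!big_ord_recl [X in _ * (X * _)]big_pred0 ?mul1r //.
congr (_ * _).
  rewrite (big_pred1 (lift ord0 ord0)).
    by rewrite lift_perm_id lift_perm_lift lift_perm_id.
  by move=> i /=; rewrite -val_eqE /=.
apply: eq_bigr => i _; rewrite big_mkcond 2!big_ord_recl /= !ifN ?mul1r ?[in RHS]big_mkcond //=.
- by apply: eq_bigr => k _; rewrite !lift_perm_lift !mxE /bump /= !add1n /= !eqSS negbK.
- by rewrite /bump /= andbF.
- by rewrite /bump /= andbF.
Qed.

Lemma rem_enum_ord n (j : 'I_n.+1) : rem j (enum 'I_n.+1) = map (lift j) (enum 'I_n).
Proof.
apply: (inj_map val_inj); apply: (irr_sorted_eq ltn_trans ltnn).
- apply: (@subseq_sorted _ ltn ltn_trans _ (iota 0 n.+1)); last exact: iota_ltn_sorted.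
  by rewrite -val_enum_ord; apply/map_subseq/rem_subseq.
- rewrite -map_comp sorted_map; apply: (@sub_sorted _ (relpre val ltn)).
    by move=> x y /=; rewrite /bump; lia.
  by rewrite -sorted_map val_enum_ord iota_ltn_sorted.
move=> k; apply/mapP/mapP => -[i].
  rewrite mem_rem_uniq ?enum_uniq // inE => /andP[/= ij _] ->.
  case: (unliftP j i) ij => [i'|] -> //; last by rewrite eqxx.
  by move=> _; exists (lift j i') => //; apply: map_f; rewrite mem_enum.
case/mapP=> i' _ -> ->; exists (lift j i') => //.
by rewrite mem_rem_uniq ?enum_uniq // inE mem_enum eq_sym neq_lift.
Qed.

(** Both sides satisfy the expansion along the first row. *)
Lemma Pf_pfw (R : comNzRingType) n (A : 'M[R]_n) : Pf A = pfw A (enum 'I_n).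
Proof.
elim: n {-2}n (leqnn n) A => [|b IH] n.
  case: n => // _ A; rewrite enum_ord0 pfw_nil /Pf.
  rewrite (big_pred1 1%g) ?big_ord0 ?odd_perm1 ?mulr1 // => s.
  rewrite [RHS](_ : _ = true); first by apply/matching_permP; split=> // -[].
  by apply/eqP/permP => -[].
case: n => [|[|n]] nb A; first exact: IH.
  by rewrite enum_ordSl enum_ord0 pfw_cons /= /Pf big1 // => s; case/and3P.
rewrite Pf_expand enum_ordSl pfw_cons contract_map contract_uniq ?enum_uniq //.
rewrite big_enum; apply: eq_bigr => j _ /=.
rewrite IH; last by lia.
rewrite index_enum_ord rem_enum_ord -map_comp pfw_map; congr (_ * _).
by apply: eq_pfw => x y; rewrite !mxE.
Qed.

Lemma Pf_on_pfw (R : comNzRingType) n (A : 'M[R]_n) (S : {set 'I_n}) :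
  Pf_on A S = pfw A (enum S).
Proof.
rewrite /Pf_on Pf_pfw.
have -> : enum S = map (fun i : 'I_#|S| => enum_val i) (enum 'I_#|S|).
  case: (set_0Vmem S) => [->|[x0 x0S]].
    by rewrite enum_set0; apply/esym/nilP; rewrite /nilp size_map size_enum_ord cards0.
  apply: (@eq_from_nth _ x0) => [|i].
    by rewrite size_map -!cardE card_ord.
  rewrite -cardE => iS.
  rewrite (nth_map (Ordinal iS)) ?size_enum_ord // (enum_val_nth x0).
  by rewrite nth_enum_ord.
by rewrite [RHS]pfw_map; apply: eq_pfw => x y; rewrite !mxE.
Qed.

(** * Pfaffian identities for a skew matrix bordered by three rows *)

Lemma rem_mid (T : eqType) (x : T) l r : x \notin l -> rem x (l ++ x :: r) = l ++ r.
Proof.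
by elim: l => /= [|y l IH]; rewrite ?eqxx // inE negb_or eq_sym => /andP[/negPf-> /IH->].
Qed.

Section BorderedWords.
Variables (R : comNzRingType) (N : nat) (B : 'M[R]_(3, N)) (A : 'M[R]_N).
Hypothesis AN : forall i j, A i j = - A j i.
Hypothesis A0 : forall i, A i i = 0.

(** The entries of the skew matrix with blocks O, B, -B^T, A, indexed by a
    disjoint sum so that border vertices and inner vertices are told apart by
    pattern matching. *)
Definition border (x y : 'I_3 + 'I_N) : R :=
  match x, y with
  | inl _, inl _ => 0
  | inl k, inr j => B k j
  | inr i, inl k => - B k i
  | inr i, inr j => A i j
  end.

Lemma borderN x y : border x y = - border y x.
Proof. by case: x y => [k|i] [l|j] /=; rewrite ?oppr0 ?opprK // AN. Qed.

Lemma border0 x : border x x = 0.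
Proof. by case: x => [k|i] /=. Qed.

Let alt := alternating_pfw borderN border0.

Definition pf2 (ps : seq 'I_3) (gs : seq 'I_N) : R :=
  pfw border (map inl ps ++ map inr gs).

Local Notation g := (enum 'I_N).

(** Expansion along a letter x that may already occur in the word: all identities
    of this part come from evaluating the left side by alternation. *)
Lemma pfw_border_cons x ps gs : uniq gs ->
  pfw border (x :: map inl ps ++ map inr gs) =
  contract (fun k => border x (inl k)) (fun u => pf2 u gs) ps +
  (-1) ^+ size ps *
  \sum_(j <- gs) (-1) ^+ index j gs * border x (inr j) * pf2 ps (rem j gs).
Proof.
move=> ugs; rewrite pfw_cons contract_cat size_map !contract_map.
by congr (_ + _ * _); rewrite contract_uniq.
Qed.

Lemma pf2_inl k ps gs : uniq gs ->
  pf2 (k :: ps) gs =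
  (-1) ^+ size ps * \sum_(j <- gs) (-1) ^+ index j gs * B k j * pf2 ps (rem j gs).
Proof.
move=> ugs; rewrite /pf2 /= pfw_border_cons //.
by rewrite contract_all0 ?add0r //; apply/allP => l _ /=.
Qed.

Lemma pfw_inr i ps gs : i \in gs -> pfw border (inr i :: map inl ps ++ map inr gs) = 0.
Proof.
move=> igs; case/splitPr: igs => l r; rewrite map_cat catA /=.
by rewrite alternating_repeat.
Qed.

Lemma pf2_repeat k ps gs : k \in ps -> pf2 (k :: ps) gs = 0.
Proof.
move=> kps; case/splitPr: kps => l r; rewrite /pf2 /= map_cat -catA /=.
by rewrite alternating_repeat.
Qed.

(** Inserting i back at its place, past the border letters and the inner letters
    below it. *)
Lemma pfw_inr_rem i ps :
  pfw border (inr i :: map inl ps ++ map inr (rem i g)) =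
  (-1) ^+ size ps * (-1) ^+ i * pf2 ps g.
Proof.
have ig : i \in g by rewrite mem_enum.
have idx := index_enum_ord i.
rewrite /pf2 -{1}idx; move: (enum_uniq 'I_N); case/splitPr: ig => l r.
rewrite cat_uniq /= negb_or => /and4P[_ /andP[il _] _ _].
rewrite index_cat (negPf il) /= eqxx addn0 rem_mid //.
rewrite !map_cat catA (alternating_move [::] _ _ _ alt) size_cat !size_map exprD /=.
by rewrite catA.
Qed.

Definition pfA : R := pf2 [::] g.
Definition pairpf : 'M[R]_3 := \matrix_(k, l) pf2 [:: k; l] g.
(** Up to signs, the Pfaffians with one border vertex deleted.  Indices are
    cyclic in Z/3, and this absorbs the alternating signs of the differentials. *)
Definition pairrow : 'rV[R]_3 := \row_k pairpf (k + 1) (k + 2).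
Definition single : 'M[R]_(3, N) :=
  \matrix_(k, j) ((-1) ^+ j.+1 * pf2 [:: k] (rem j g)).
Definition triple : 'rV[R]_N :=
  \row_j ((-1) ^+ j.+1 * pf2 (enum 'I_3) (rem j g)).
(** The Pfaffian adjoint relative to a fixed list of border vertices: removing
    c and then j. *)
Definition adjoint (ps : seq 'I_3) : 'M[R]_N :=
  \matrix_(j, c) if j == c then 0 else
    (-1) ^+ c * (-1) ^+ index j (rem c g) * pf2 ps (rem j (rem c g)).

Lemma enum_ord3 : enum 'I_3 = [:: 0; 1; 2].
Proof. by apply: (inj_map val_inj); rewrite val_enum_ord. Qed.

Lemma pairpfN k l : pairpf k l = - pairpf l k.
Proof. by rewrite !mxE; apply: (alt.1 [::]). Qed.

Lemma pairpf0 k : pairpf k k = 0.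
Proof. by rewrite !mxE pf2_repeat ?inE. Qed.

Lemma pf2_cyclic i gs : pf2 [:: i; i + 1; i + 2] gs = pf2 (enum 'I_3) gs.
Proof.
rewrite enum_ord3 /pf2; case: i => [[|[|[|]]]] // ?.
- by congr (pfw _ (_ :: _ :: _ :: _)); congr inl; apply: val_inj.
- rewrite /= [RHS](alternating_move [::] _ [:: inl 1; inl 2] _ alt) /= expr2 mulrNN !mul1r.
  by congr (pfw _ (_ :: _ :: _ :: _)); congr inl; apply: val_inj.
- rewrite /= -[RHS]mul1r -[X in X * _]mul1r -[X in X * _]mulrNN -expr2.
  rewrite -(alternating_move [::] _ [:: inl 0; inl 1] _ alt) /=.
  by congr (pfw _ (_ :: _ :: _ :: _)); congr inl; apply: val_inj.
Qed.

Lemma trmxA : A^T = - A.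
Proof. by apply/matrixP => i j; rewrite !mxE AN. Qed.

(** Expand the vanishing Pfaffian of the word r, k, 1 .. N, where r is repeated. *)
Lemma mul_A_single : A *m single^T = pfA *: B^T.
Proof.
apply/matrixP => r k; rewrite !mxE.
have := @pfw_inr r [:: k] g; rewrite mem_enum => /(_ isT)/eqP.
rewrite pfw_border_cons ?enum_uniq //= subr0 expr1 mulN1r subr_eq0 => /eqP e.
rewrite [RHS]mulrC -[RHS]opprK -mulNr [in RHS]e -sumrN big_enum.
by apply: eq_bigr => j _; rewrite !mxE index_enum_ord exprS; ring.
Qed.

Lemma mul_B_single : B *m single^T = pairpf.
Proof.
apply/matrixP => k l; rewrite !mxE pf2_inl ?enum_uniq //= expr1 mulN1r -sumrN big_enum.
by apply: eq_bigr => j _; rewrite !mxE index_enum_ord exprS; ring.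
Qed.

Lemma mul_B_triple : B *m triple^T = 0.
Proof.
apply/matrixP => k l; rewrite !mxE.
have := @pf2_repeat k (enum 'I_3) g; rewrite mem_enum => /(_ isT).
rewrite pf2_inl ?enum_uniq // => /(congr1 ( *%R ((-1) ^+ size (enum 'I_3)))).
rewrite signrMK mulr0 big_enum => e; rewrite -[RHS]oppr0 -[in RHS]e -sumrN.
by apply: eq_bigr => j _; rewrite !mxE index_enum_ord exprS; ring.
Qed.

(** Expand the vanishing Pfaffian of the word r, 1', 2', 3', 1 .. N. *)
Lemma mul_A_triple : A *m triple^T = B^T *m pairrow^T.
Proof.
apply/matrixP => r l; rewrite !mxE.
have := @pfw_inr r (enum 'I_3) g; rewrite mem_enum => /(_ isT).
rewrite pfw_border_cons ?enum_uniq // {1 2}enum_ord3 /=.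
set S := \sum_(j <- g) _ => e.
transitivity (- S).
  rewrite /S big_enum -sumrN; apply: eq_bigr => j _.
  by rewrite !mxE index_enum_ord exprS; ring.
have pN := pairpfN 0 2; rewrite !mxE in pN.
rewrite !big_ord_recl big_ord0 !mxE.
set l1 := lift ord0 ord0; set l2 := lift ord0 _.
have -> : l1 = 1 by apply: val_inj.
have -> : l2 = 2 by apply: val_inj.
have -> : 0 + 1 = 1 :> 'I_3 by apply: val_inj.
have -> : 0 + 2 = 2 :> 'I_3 by apply: val_inj.
have -> : 1 + 1 = 2 :> 'I_3 by apply: val_inj.
have -> : 1 + 2 = 0 :> 'I_3 by apply: val_inj.
have -> : 2 + 1 = 0 :> 'I_3 by apply: val_inj.
have -> : 2 + 2 = 1 :> 'I_3 by apply: val_inj.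
have -> : ord0 = 0 :> 'I_3 by apply: val_inj.
by apply/eqP; rewrite -subr_eq0; apply/eqP; rewrite -[RHS]e pN; ring.
Qed.

Lemma adjointE (f : 'I_N -> R) ps c :
  \sum_j f j * adjoint ps j c = (-1) ^+ c *
    \sum_(j <- rem c g) (-1) ^+ index j (rem c g) * f j * pf2 ps (rem j (rem c g)).
Proof.
rewrite (bigD1 c) //= mxE eqxx mulr0 add0r mulr_sumr.
rewrite [in X in _ = \sum_(_ <- X) _]rem_filter ?enum_uniq // big_filter big_enum_cond /=.
apply: eq_big => [j|j jc] //.
by rewrite mxE (negPf jc); ring.
Qed.

Lemma mul_B_adjoint ps :
  B *m adjoint ps = \matrix_(k, c) ((-1) ^+ c * (-1) ^+ size ps * pf2 (k :: ps) (rem c g)).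
Proof.
apply/matrixP => k c; rewrite !mxE adjointE.
by rewrite pf2_inl ?rem_uniq ?enum_uniq // -mulrA signrMK.
Qed.

(** Expand the Pfaffian of the word r, ps, 1 .. N without c: it vanishes unless r
    is the missing letter c. *)
Lemma mul_A_adjoint ps :
  A *m adjoint ps = \matrix_(r, c) ((r == c)%:R * pf2 ps g
    - (-1) ^+ c * (-1) ^+ size ps *
      contract (fun k => - B k r) (fun u => pf2 u (rem c g)) ps).
Proof.
apply/matrixP => r c; rewrite !mxE adjointE.
have := @pfw_border_cons (inr r) ps (rem c g); rewrite rem_uniq ?enum_uniq // => /(_ isT).
set S := \sum_(j <- _) _; set C := contract _ _ _ => e.
have {e}e : S = (-1) ^+ size ps * (pfw border (inr r :: map inl ps ++ map inr (rem c g)) - C).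
  by rewrite e [C + _]addrC addrK signrMK.
transitivity ((-1) ^+ c * S); first by []. rewrite e.
have [->|rc] := eqVneq r c.
  rewrite pfw_inr_rem mulr1n -[pf2 ps g in RHS](signrMK c) -{2}[pf2 ps g](signrMK (size ps)).
  by ring.
rewrite pfw_inr; last by rewrite mem_rem_uniq ?enum_uniq // inE rc mem_enum.
by rewrite mulr0n; ring.
Qed.

Lemma mul_A_adjoint0 : A *m adjoint [::] = pfA%:M.
Proof.
rewrite mul_A_adjoint; apply/matrixP => r c; rewrite !mxE /=.
by rewrite mulr0 subr0 mulr_natl.
Qed.

Lemma mul_B_adjoint0 : B *m adjoint [::] = - single.
Proof.
rewrite mul_B_adjoint; apply/matrixP => r c; rewrite !mxE /= exprS; ring.
Qed.

Definition skew_delta (k l : 'I_3) : 'M[R]_3 := delta_mx k l - delta_mx l k.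

Lemma mul_A_adjoint2 k l :
  A *m adjoint [:: k; l] = (pairpf k l)%:M - B^T *m skew_delta k l *m single.
Proof.
rewrite mul_A_adjoint /skew_delta -mulmxA mulmxBl mulmxBr.
apply/matrixP => r c; rewrite !mxE /=.
have E (p q : 'I_3) : \sum_j B^T r j * (delta_mx p q *m single) j c = B p r * single q c.
  rewrite (bigD1 p) //= big1 ?addr0; last first.
    move=> i ip; rewrite !mxE big1 ?mulr0 // => j _.
    by rewrite !mxE (negPf ip) mul0r.
  rewrite !mxE (bigD1 q) //= big1 ?addr0 ?mxE ?eqxx ?mul1r // => j jq.
  by rewrite !mxE (negPf jq) andbF mul0r.
rewrite !E !mxE exprS mulr_natl !exprS; congr (_ - _); ring.
Qed.

End BorderedWords.

(** * The complex and its null-homotopies *)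

(** Multiplication by x is null-homotopic on the complex in degrees 0, 1 and 2,
    where its homology could obstruct exactness. *)
Definition null_homotopic (R : comNzRingType) r1 r2 r3 (d1 : 'M[R]_(1, r1))
    (d2 : 'M[R]_(r1, r2)) (d3 : 'M[R]_(r2, r3)) (x : R) : Prop :=
  exists (h0 : 'M[R]_(r1, 1)) (h1 : 'M[R]_(r2, r1)) (h2 : 'M[R]_(r3, r2)),
    [/\ d1 *m h0 = x%:M, h0 *m d1 + d2 *m h1 = x%:M & h1 *m d2 + d3 *m h2 = x%:M].

Lemma null_homotopicZ (R : comNzRingType) r1 r2 r3 (d1 : 'M[R]_(1, r1))
    (d2 : 'M[R]_(r1, r2)) (d3 : 'M[R]_(r2, r3)) a x :
  null_homotopic d1 d2 d3 x -> null_homotopic d1 d2 d3 (a * x).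
Proof.
case=> h0 [h1 [h2 [e0 e1 e2]]]; exists (a *: h0), (a *: h1), (a *: h2).
by rewrite -!scalemxAr -!scalemxAl -!scalerDr e0 e1 e2 !scale_scalar_mx.
Qed.

Section PfaffianComplex.
Variables (R : comNzRingType) (N : nat) (B : 'M[R]_(3, N)) (A : 'M[R]_N).
Hypothesis AN : forall i j, A i j = - A j i.
Hypothesis A0 : forall i, A i i = 0.

Local Notation pfA := (pfA B A).
Local Notation pairpf := (pairpf B A).
Local Notation pairrow := (pairrow B A).
Local Notation single := (single B A).
Local Notation triple := (triple B A).
Local Notation adjoint := (adjoint B A).

Definition d1_of : 'M[R]_(1, 3 + 1) := row_mx (- pairrow) pfA%:M.
Definition d2_of : 'M[R]_(3 + 1, 3 + N) := block_mx pfA%:M single pairrow triple.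
Definition d3_of : 'M[R]_(3 + N, N) := col_mx B A.

Lemma mul_single_A : single *m A = - (pfA *: B).
Proof.
by apply: trmx_inj; rewrite trmx_mul (trmxA AN) mulNmx (mul_A_single B AN A0) [RHS]linearN [in RHS]linearZ.
Qed.

Lemma mul_triple_A : triple *m A = - (pairrow *m B).
Proof.
by apply: trmx_inj; rewrite trmx_mul (trmxA AN) mulNmx (mul_A_triple B AN A0) linearN /= trmx_mul.
Qed.

Lemma mul_single_B : single *m B^T = - pairpf.
Proof.
apply: trmx_inj; rewrite trmx_mul trmxK (mul_B_single B A) linearN /=.
by apply/matrixP => k l; rewrite [RHS]mxE [in RHS]mxE pairpfN.
Qed.

Lemma mul_triple_B : triple *m B^T = 0.
Proof. by apply: trmx_inj; rewrite trmx_mul trmxK (mul_B_triple B AN A0) trmx0. Qed.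

Lemma mul_d2_d3 : d2_of *m d3_of = 0.
Proof.
rewrite mul_block_col mul_scalar_mx mul_single_A mul_triple_A.
by rewrite !addrN col_mx0.
Qed.

(** The product vanishes on the first three columns by inspection.  On the others
    it is a row r with [r * A = 0], since [d2 * d3 = 0], and A divides
    the nonzerodivisor Pf(A) through its adjoint. *)
Lemma mul_d1_d2 : GRing.lreg pfA -> d1_of *m d2_of = 0.
Proof.
move=> regA.
have d1d2 : d1_of *m d2_of = row_mx 0 (- pairrow *m single + pfA *: triple).
  rewrite mul_row_block mul_mx_scalar !mul_scalar_mx scalerN addNr.
  by [].
have e : (- pairrow *m single + pfA *: triple) *m A = 0.
  have := congr1 (mulmx d1_of) mul_d2_d3.
  by rewrite mulmxA mulmx0 d1d2 mul_row_col mul0mx add0r.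
rewrite d1d2; apply/eqP; rewrite row_mx_eq0 eqxx /=; apply/eqP.
have {e}/matrixP e := congr1 (mulmx^~ (adjoint [::])) e.
apply/matrixP => i j; move: (e i j).
rewrite mul0mx -mulmxA (mul_A_adjoint0 B AN A0) mul_mx_scalar mxE [RHS]mxE => eij.
by apply: regA; rewrite eij [X in _ = _ * X]mxE mulr0.
Qed.

Lemma d3_inj (v : 'cV[R]_N) : GRing.lreg pfA -> d3_of *m v = 0 -> v = 0.
Proof.
move=> regA; rewrite mul_col_mx => /eqP; rewrite col_mx_eq0 => /andP[_ /eqP Av].
have e : (adjoint [::])^T *m A = (- pfA)%:M.
  apply: trmx_inj; rewrite trmx_mul trmxK (trmxA AN) mulNmx (mul_A_adjoint0 B AN A0).
  by rewrite tr_scalar_mx raddfN.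
have := congr1 (mulmx (adjoint [::])^T) Av.
rewrite mulmxA e mulmx0 mul_scalar_mx => /matrixP ev.
apply/matrixP => i j; apply: regA; move: (ev i j).
by rewrite !mxE mulNr mulr0 => /eqP; rewrite oppr_eq0 => /eqP.
Qed.

Lemma null_homotopic_pfA : null_homotopic d1_of d2_of d3_of pfA.
Proof.
exists (col_mx 0 1%:M), (block_mx 1%:M 0 0 0), (row_mx 0 (adjoint [::])); split.
- by rewrite mul_row_col mulmx0 add0r mulmx1.
- rewrite mul_col_row mulmx_block !mul1mx !mulmx0 !mul0mx !mulmx1 !addr0.
  by rewrite add_block_mx !add0r !addr0 addNr -scalar_mx_block.
- rewrite mul_col_row mulmx_block !mul1mx !mulmx0 !mul0mx !addr0.
  rewrite (mul_A_adjoint0 B AN A0) (mul_B_adjoint0 B A) add_block_mx !add0r !addr0 addrN.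
  by rewrite -scalar_mx_block.
Qed.

(** The homotopy is multiplication by the i-th generator in the algebra structure
    carried by the complex.  Its blocks are S, which exchanges up to sign the two other
    border vertices p and q, and the adjoint relative to p and q. *)
Lemma null_homotopic_pair (i : 'I_3) :
  null_homotopic d1_of d2_of d3_of (pairpf (i + 1) (i + 2)).
Proof.
set p := i + 1; set q := i + 2; set x := pairpf p q.
pose e : 'cV[R]_3 := delta_mx i 0; pose S := skew_delta R p q.
(* Entrywise, with (p, q, i) cyclic, this is skewness of the pair matrix. *)
have eRXS : e *m pairrow - pairpf *m S = x%:M.
  have pXS k l : (pairpf *m S) k l = pairpf k p *+ (q == l) - pairpf k q *+ (p == l).
    have pd (a b : 'I_3) : (pairpf *m delta_mx a b) k l = pairpf k a *+ (b == l).
      rewrite mxE (bigD1 a) //= big1 ?addr0 => [|j ja].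
        by rewrite [delta_mx _ _ _ _]mxE eqxx (eq_sym l) mulr_natr.
      by rewrite [delta_mx _ _ _ _]mxE (negPf ja) mulr0.
    by rewrite mulmxBr mxE [X in _ + X]mxE !pd.
  have eR k l : (e *m pairrow) k l = pairpf (l + 1) (l + 2) *+ (k == i).
    by rewrite mxE big_ord1 !mxE andbT mulr_natl.
  apply/matrixP => k l; rewrite mxE [X in _ + X]mxE pXS eR [RHS]mxE /x.
  have [p1 p2 q1 q2] : [/\ p + 1 = q, p + 2 = i, q + 1 = i & q + 2 = p].
    by rewrite /p /q; case: (i) => [[|[|[|]]]] // ?; split; apply: val_inj.
  have [ip iq pq] : [/\ (i == p) = false, (i == q) = false & (p == q) = false].
    by rewrite /p /q; case: (i) => [[|[|[|]]]].
  have cases j : [\/ j = i, j = p | j = q].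
    rewrite /p /q; case: (i) (j) => [[|[|[|]]]] // ? [[|[|[|]]]] // ?;
      by [apply: Or31; apply: val_inj | apply: Or32; apply: val_inj
         | apply: Or33; apply: val_inj].
  have XN := @pairpfN _ _ B A AN A0; have X0 := @pairpf0 _ _ B A AN A0.
  case: (cases k) => ->; case: (cases l) => ->;
    rewrite ?p1 ?p2 ?q1 ?q2 -/p -/q ?eqxx ?[q == p]eq_sym ?[p == i]eq_sym ?[q == i]eq_sym
      ?ip ?iq ?pq ?mulr1n ?mulr0n ?X0
      ?(subrr, subr0, sub0r, add0r, addr0, opprK) //;
    by rewrite ?oppr0 // XN ?addNr.
have Re : pairrow *m e = x%:M.
  apply/matrixP => k l; rewrite !ord1 !mxE (bigD1 i) //= big1 ?addr0.
    by rewrite /x /p /q !mxE !eqxx mulr1.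
  by move=> j ji; rewrite !mxE (negPf ji) mulr0.
have Se : S *m e = 0.
  rewrite mulmxBl !mul_delta_mx_cond /q /p.
  by case: i {e S x p q eRXS Re} => [[|[|[|]]]] //= ?; rewrite subrr.
have Be : B *m adjoint [:: p; q] = - (e *m triple).
  rewrite mul_B_adjoint; apply/matrixP => k c.
  rewrite [RHS]mxE [X in _ = - X]mxE big_ord1 !mxE andbT.
  have [->|ki] := eqVneq k i.
    by rewrite (pf2_cyclic B AN A0) !exprS /=; ring.
  rewrite pf2_repeat ?mulr0 ?mul0r ?oppr0 // !inE.
  by rewrite /p /q; case: (i) (k) ki => [[|[|[|]]]] // ? [[|[|[|]]]].
exists (col_mx (- e) 0), (block_mx 0 e (B^T *m S) 0),
  (row_mx (- (single^T *m S)) (adjoint [:: p; q])); split.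
- by rewrite mul_row_col mulmx0 addr0 mulmxN mulNmx opprK Re.
- rewrite mul_col_row mulmx_block !mul0mx !mulmx0 !addr0 !add0r.
  rewrite !mulmxA mul_single_B mul_triple_B !mul0mx mulNmx mulmxN mulNmx opprK Re.
  rewrite mul_mx_scalar mul_scalar_mx add_block_mx addNr !add0r mulNmx eRXS.
  by rewrite -scalar_mx_block.
- rewrite mul_col_row mulmx_block !mul0mx !add0r !addr0.
  rewrite (mul_A_adjoint2 B AN A0) !mulmxN !mulmxA (mul_B_single B A) (mul_A_single B AN A0).
  rewrite add_block_mx.
  rewrite Be addrN eRXS mul_mx_scalar -scalemxAl subrr addrC subrK.
  by rewrite -scalar_mx_block.
Qed.

End PfaffianComplex.

(** * Ideals, matrices modulo an ideal, and acyclicity *)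

Section Ideals.
Variable R : comNzRingType.
Implicit Types (s I : seq R) (x y : R).

Lemma in_ideal_nil x : in_ideal [::] x <-> x = 0.
Proof.
by split=> [[a ->]|->]; [rewrite big_ord0 | exists (fun=> 0); rewrite big_ord0].
Qed.

Lemma in_ideal_cons y s x : in_ideal (y :: s) x <-> exists a, in_ideal s (x - a * y).
Proof.
split=> [[a ->]|[a [b e]]].
  exists (a ord0), (fun i => a (lift ord0 i)).
  by rewrite big_ord_recl /= addrC addrA addNr add0r.
exists (fun i => if unlift ord0 i is Some j then b j else a).
rewrite big_ord_recl unlift_none /= -[LHS](addrNK (a * y)) e addrC; congr (_ + _).
by apply: eq_bigr => i _; rewrite liftK.
Qed.

Lemma in_ideal_rcons y s x : in_ideal (rcons s y) x <-> exists a, in_ideal s (x - a * y).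
Proof.
elim: s x => [|z s IH] x; first by apply: in_ideal_cons.
rewrite rcons_cons in_ideal_cons; split.
  case=> a /IH[b e]; exists b; apply/in_ideal_cons; exists a.
  by rewrite -addrA [- _ - _]addrC addrA.
case=> b /in_ideal_cons[a e]; exists a; apply/IH; exists b.
by rewrite -addrA [- _ - _]addrC addrA.
Qed.

Lemma in_ideal0 s : in_ideal s 0.
Proof. by exists (fun=> 0); rewrite big1 // => i _; rewrite mul0r. Qed.

Lemma in_idealD s x y : in_ideal s x -> in_ideal s y -> in_ideal s (x + y).
Proof.
move=> [a ->] [b ->]; exists (fun i => a i + b i).
by rewrite -big_split; apply: eq_bigr => i _; rewrite mulrDl.
Qed.

Lemma in_idealMl s a x : in_ideal s x -> in_ideal s (a * x).
Proof.
move=> [b ->]; exists (fun i => a * b i).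
by rewrite mulr_sumr; apply: eq_bigr => i _; rewrite mulrA.
Qed.

Lemma in_idealMr s a x : in_ideal s x -> in_ideal s (x * a).
Proof. by rewrite mulrC; apply: in_idealMl. Qed.

Lemma in_ideal_mem s x : x \in s -> in_ideal s x.
Proof.
elim: s => // y s IH; rewrite inE => /orP[/eqP->|/IH xs]; apply/in_ideal_cons.
  by exists 1; rewrite mul1r subrr; apply: in_ideal0.
by exists 0; rewrite mul0r subr0.
Qed.

Lemma in_ideal_sum (T : Type) (r : seq T) (P : pred T) (F : T -> R) s :
  (forall i, P i -> in_ideal s (F i)) -> in_ideal s (\sum_(i <- r | P i) F i).
Proof. by move=> sF; apply: big_ind => //; [apply: in_ideal0 | apply: in_idealD]. Qed.

Lemma in_ideal_trans s I x : {in s, forall y, in_ideal I y} -> in_ideal s x -> in_ideal I x.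
Proof.
move=> sI [a ->]; apply: in_ideal_sum => i _; apply: in_idealMl.
exact/sI/mem_nth.
Qed.

Lemma in_ideal_mkseq (f : nat -> R) i x :
  in_ideal (mkseq f i) x <-> exists a : nat -> R, x = \sum_(j < i) a j * f j.
Proof.
elim: i x => [|i IH] x.
  rewrite in_ideal_nil; split=> [->|[a ->]]; last by rewrite big_ord0.
  by exists (fun=> 0); rewrite big_ord0.
have -> : mkseq f i.+1 = rcons (mkseq f i) (f i).
  by rewrite /mkseq -[in LHS]addn1 iotaD map_cat cats1.
rewrite in_ideal_rcons; split=> [[a /IH[b e]]|[b ->]].
  exists (fun j => if j == i then a else b j).
  rewrite big_ord_recr /= eqxx -[LHS](subrK (a * f i)) e; congr (_ + _).
  by apply: eq_bigr => j _; rewrite ltn_eqF.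
by exists (b i); apply/IH; exists b; rewrite big_ord_recr /= addrK.
Qed.

Definition mx_in I m n (M : 'M[R]_(m, n)) := forall i j, in_ideal I (M i j).

Lemma mx_inD I m n (M M' : 'M[R]_(m, n)) : mx_in I M -> mx_in I M' -> mx_in I (M + M').
Proof. by move=> H H' i j; rewrite mxE; apply: in_idealD. Qed.

Lemma mx_inMr I m n p (M : 'M[R]_(m, n)) (M' : 'M[R]_(n, p)) : mx_in I M -> mx_in I (M *m M').
Proof. by move=> H i j; rewrite mxE; apply: in_ideal_sum => k _; apply: in_idealMr. Qed.

Lemma mx_inMl I m n p (M : 'M[R]_(m, n)) (M' : 'M[R]_(n, p)) : mx_in I M' -> mx_in I (M *m M').
Proof. by move=> H i j; rewrite mxE; apply: in_ideal_sum => k _; apply: in_idealMl. Qed.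

Lemma mx_choice m n (P : 'I_m -> 'I_n -> R -> Prop) :
  (forall i j, exists c, P i j c) -> exists C : 'M_(m, n), forall i j, P i j (C i j).
Proof.
move=> H; have /choice[f fP] : forall ij : 'I_m * 'I_n, exists c, P ij.1 ij.2 c.
  by move=> ij; apply: H.
by exists (\matrix_(i, j) f (i, j)) => i j; rewrite mxE; apply: (fP (i, j)).
Qed.

(** Exactness is stated for vectors; this is its columnwise form. *)
Lemma exact_lift p q r n (d : 'M[R]_(p, q)) (d' : 'M[R]_(q, r)) (V : 'M[R]_(q, n)) :
  exact_at d d' -> d *m V = 0 -> exists W, V = d' *m W.
Proof.
move=> ex dV; have /choice[f fP] : forall j, exists w, col j V = d' *m w.
  by move=> j; apply/ex; rewrite colE mulmxA dV mul0mx.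
exists (\matrix_(i, j) f j i 0); apply/matrixP => i j.
have /matrixP/(_ i 0) := fP j; rewrite !mxE => ->.
by apply: eq_bigr => k _; rewrite mxE.
Qed.

End Ideals.

Section Acyclicity.
Variables (R : comNzRingType) (x1 x2 x3 : R).
Hypothesis reg1 : forall a, x1 * a = 0 -> a = 0.
Hypothesis reg2 : forall a b, x2 * a = x1 * b -> exists c, a = x1 * c.
Hypothesis reg3 : forall a b c, x3 * a = x1 * b + x2 * c -> exists d e, a = x1 * d + x2 * e.

Lemma mx_reg1 m n (V W : 'M[R]_(m, n)) : x1 *: V = x1 *: W -> V = W.
Proof.
move=> /matrixP e; apply/matrixP => i j; apply/eqP; rewrite -subr_eq0; apply/eqP.
by apply: reg1; move: (e i j); rewrite !mxE mulrBr => ->; rewrite subrr.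
Qed.

Lemma mx_reg2 m n (V W : 'M[R]_(m, n)) : x2 *: V = x1 *: W -> exists C, V = x1 *: C.
Proof.
move=> /matrixP e; have [i j|C CP] := mx_choice (P := fun i j c => V i j = x1 * c).
  by apply: (@reg2 _ (W i j)); move: (e i j); rewrite !mxE.
by exists C; apply/matrixP => i j; rewrite mxE.
Qed.

Lemma mx_reg3 m n (V W W' : 'M[R]_(m, n)) :
  x3 *: V = x1 *: W + x2 *: W' -> exists C C', V = x1 *: C + x2 *: C'.
Proof.
move=> /matrixP e.
have [i j|C CP] := mx_choice (P := fun i j c => exists c', V i j = x1 * c + x2 * c').
  by apply: (@reg3 _ (W i j) (W' i j)); move: (e i j); rewrite !mxE.
have [C' CP'] := mx_choice CP.
by exists C, C'; apply/matrixP => i j; rewrite !mxE.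
Qed.

Variables (r1 r2 r3 : nat) (d1 : 'M[R]_(1, r1)) (d2 : 'M[R]_(r1, r2)) (d3 : 'M[R]_(r2, r3)).
Hypotheses (d12 : d1 *m d2 = 0) (d23 : d2 *m d3 = 0).
Hypothesis d3inj : forall v : 'cV_r3, d3 *m v = 0 -> v = 0.
Hypotheses (nh1 : null_homotopic d1 d2 d3 x1) (nh2 : null_homotopic d1 d2 d3 x2)
  (nh3 : null_homotopic d1 d2 d3 x3).

Lemma null_homotopic_exact_mod2 x (v : 'cV_r2) :
  null_homotopic d1 d2 d3 x -> d2 *m v = 0 -> exists w, x *: v = d3 *m w.
Proof.
case=> h0 [h1 [h2 [_ _ e]]] v0; exists (h2 *m v).
by rewrite -mul_scalar_mx -e mulmxDl -[h1 *m d2 *m v]mulmxA v0 mulmx0 add0r mulmxA.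
Qed.

Lemma null_homotopic_exact_mod1 x (v : 'cV_r1) :
  null_homotopic d1 d2 d3 x -> d1 *m v = 0 -> exists w, x *: v = d2 *m w.
Proof.
case=> h0 [h1 [h2 [_ e _]]] v0; exists (h1 *m v).
by rewrite -mul_scalar_mx -e mulmxDl -[h0 *m d1 *m v]mulmxA v0 mulmx0 add0r mulmxA.
Qed.

Lemma d3_cancel (v w : 'cV_r3) : d3 *m v = d3 *m w -> v = w.
Proof.
move=> e; apply/eqP; rewrite -subr_eq0; apply/eqP/d3inj.
by rewrite mulmxBr e subrr.
Qed.

(** If x1 and x2 both carry v into the image, say to [d3 w1] and [d3 w2], then
    [x2 w1 = x1 w2] because d3 is injective, so x1 divides w1 and cancels. *)
Lemma acyclic_exact2 : exact_at d2 d3.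
Proof.
move=> v; split=> [v0|[w ->]]; last by rewrite mulmxA d23 mul0mx.
have [w1 e1] := null_homotopic_exact_mod2 nh1 v0.
have [w2 e2] := null_homotopic_exact_mod2 nh2 v0.
have [t tP] : exists t, w1 = x1 *: t.
  apply: (@mx_reg2 _ _ w1 w2); apply: d3_cancel.
  by rewrite -!scalemxAr -e1 -e2 !scalerA mulrC.
by exists t; apply: mx_reg1; rewrite e1 tP scalemxAr.
Qed.

(** The same argument one step further left: x1, x2, x3 carry v to d2 of w1, w2,
    w3, whose pairwise Koszul differences are images under d3 of t12, t13, t23.
    The Koszul relation between these puts t12 in (x1, x2); after correcting w1
    by a boundary, x1 divides it and cancels. *)
Lemma acyclic_exact1 : exact_at d1 d2.
Proof.
move=> v; split=> [v0|[w ->]]; last by rewrite mulmxA d12 mul0mx.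
have [w1 e1] := null_homotopic_exact_mod1 nh1 v0.
have [w2 e2] := null_homotopic_exact_mod1 nh2 v0.
have [w3 e3] := null_homotopic_exact_mod1 nh3 v0.
have cycle x y w w' : x *: v = d2 *m w -> y *: v = d2 *m w' ->
    exists t, y *: w - x *: w' = d3 *m t.
  move=> e e'; apply/acyclic_exact2; rewrite mulmxBr -!scalemxAr -e -e' !scalerA.
  by rewrite mulrC subrr.
have [t12 f12] := cycle _ _ _ _ e1 e2.
have [t13 f13] := cycle _ _ _ _ e1 e3.
have [t23 f23] := cycle _ _ _ _ e2 e3.
(* x3 t12 - x2 t13 + x1 t23 = 0, by injectivity of d3. *)
have [a [b ab]] : exists a b, t12 = x1 *: a + x2 *: b.
  apply: (@mx_reg3 _ _ t12 (- t23) t13); apply: d3_cancel.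
  rewrite mulmxDr -!scalemxAr mulmxN -f12 -f13 -f23.
  by apply/matrixP => i j; rewrite !mxE; ring.
have [t tP] : exists t, w1 - d3 *m b = x1 *: t.
  apply: (@mx_reg2 _ _ _ (w2 + d3 *m a)); apply/eqP; rewrite -subr_eq0; apply/eqP.
  transitivity ((x2 *: w1 - x1 *: w2) - d3 *m (x1 *: a + x2 *: b)).
    by rewrite mulmxDr -!scalemxAr; apply/matrixP => i j; rewrite !mxE; ring.
  by rewrite f12 ab subrr.
exists t; apply: mx_reg1; rewrite scalemxAr -tP mulmxBr mulmxA d23 mul0mx subr0.
exact: e1.
Qed.

End Acyclicity.

(** * Length of regular sequences in a resolved ideal *)

Lemma cyclic_proj_eq0 (R : comNzRingType) (I : seq R) x : cyclic_proj I x = 0 <-> in_ideal I x.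
Proof.
have p0 : cyclic_proj I 0 = 0.
  by apply: (addIr (cyclic_proj I 0)); rewrite -cyclic_projD !add0r.
split=> [e|xI].
  by apply/asboolP; rewrite -[x]subr0; apply/cyclic_projP; rewrite e p0.
by rewrite -p0; apply/cyclic_projP; rewrite subr0; apply/asboolP.
Qed.

Section Resolutions.
Variables (R : comNzRingType) (I : seq R) (r1 r2 r3 : nat).
Variables (d1 : 'M[R]_(1, r1)) (d2 : 'M[R]_(r1, r2)) (d3 : 'M[R]_(r2, r3)).
Hypothesis resI : free_resolution I d1 d2 d3.

Lemma resolution_in_ideal x : in_ideal I x <-> exists v : 'cV_r1, x%:M = d1 *m v.
Proof. by case: resI => H _ _ _; rewrite -H cyclic_proj_eq0. Qed.

Lemma resolution_d12 : d1 *m d2 = 0.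
Proof.
case: resI => _ ex _ _; apply/matrixP => i j.
have e : d1 *m (d2 *m delta_mx j (0 : 'I_1)) = 0 by apply/ex; exists (delta_mx j 0).
by have /matrixP/(_ i 0) := e; rewrite mulmxA -colE mxE => ->; rewrite !mxE.
Qed.

Lemma resolution_d23 : d2 *m d3 = 0.
Proof.
case: resI => _ _ ex _; apply/matrixP => i j.
have e : d2 *m (d3 *m delta_mx j (0 : 'I_1)) = 0 by apply/ex; exists (delta_mx j 0).
by have /matrixP/(_ i 0) := e; rewrite mulmxA -colE mxE => ->; rewrite !mxE.
Qed.

Lemma resolution_cancel n (V W : 'M_(r3, n)) : d3 *m V = d3 *m W -> V = W.
Proof.
case: resI => _ _ _ inj e; apply/matrixP => i j; apply/eqP; rewrite -subr_eq0; apply/eqP.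
have /matrixP/(_ i 0) : col j (V - W) = 0.
  by apply: inj; rewrite colE mulmxA mulmxBr e subrr mul0mx.
by rewrite !mxE.
Qed.

(** Comparison theorem for multiplication by x: it lifts the zero map on the
    resolved module. *)
Lemma resolution_homotopy x : in_ideal I x ->
  exists (h0 : 'M_(r1, 1)) (h1 : 'M_(r2, r1)) (h2 : 'M_(r3, r2)),
    [/\ d1 *m h0 = x%:M, h0 *m d1 + d2 *m h1 = x%:M,
        h1 *m d2 + d3 *m h2 = x%:M & h2 *m d3 = x%:M].
Proof.
move/resolution_in_ideal=> [h0 e0]; have [_ ex1 ex2 _] := resI.
have [|h1 e1] := exact_lift (V := x%:M - h0 *m d1) ex1.
  by rewrite mulmxBr mulmxA -e0 mul_mx_scalar mul_scalar_mx subrr.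
have [|h2 e2] := exact_lift (V := x%:M - h1 *m d2) ex2.
  rewrite mulmxBr mulmxA -e1 mulmxBl -mulmxA resolution_d12 mulmx0 subr0.
  by rewrite mul_mx_scalar mul_scalar_mx subrr.
exists h0, h1, h2; split.
- by rewrite -e0.
- by rewrite -e1 addrC subrK.
- by rewrite -e2 addrC subrK.
apply: resolution_cancel; rewrite mulmxA -e2 mulmxBl -mulmxA resolution_d23 mulmx0 subr0.
by rewrite mul_mx_scalar mul_scalar_mx.
Qed.

(** The long exact sequence of 0 -> R/J -s-> R/J -> R/(J, s) -> 0 for the dual
    complex, in terms of row vectors: as s acts by zero on cohomology, cohomology
    in one degree modulo J is a quotient of cohomology one degree lower modulo
    (J, s). *)
Lemma cohomology_step z a b c J s (d : 'M[R]_(a, b)) (d' : 'M[R]_(b, c))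
    (dp : 'M[R]_(z, a)) (h : 'M_(b, a)) (h' : 'M_(c, b)) :
    dp *m d = 0 -> h *m d + d' *m h' = s%:M ->
    (forall x, in_ideal J (s * x) -> in_ideal J x) ->
    (forall w : 'rV_a, mx_in (rcons J s) (w *m d) ->
       exists w' : 'rV_z, mx_in (rcons J s) (w - w' *m dp)) ->
  forall v : 'rV_b, mx_in J (v *m d') -> exists t : 'rV_a, mx_in J (v - t *m d).
Proof.
move=> dpd hs reg IH v vJ.
have vs : v *m h *m d = s *: v - v *m d' *m h'.
  rewrite -(mul_mx_scalar s v) -hs mulmxDr !mulmxA addrK //.
have [|w' w'P] := IH (v *m h).
  rewrite vs => i j; apply/in_ideal_rcons; exists (v i j).
  rewrite !mxE mulrC addrAC subrr sub0r -mulN1r; apply: in_idealMl.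
  have := mx_inMr h' vJ; move/(_ i j); by rewrite !mxE.
have [i j|T TP] := mx_choice (P := fun i j t =>
    in_ideal J ((v *m h - w' *m dp) i j - t * s)).
  by apply/in_ideal_rcons; apply: w'P.
exists T => i j; apply: reg.
have -> : s * (v - T *m d) i j =
    ((v *m h - w' *m dp - s *: T) *m d + v *m d' *m h') i j.
  rewrite !mulmxBl vs -[w' *m dp *m d]mulmxA dpd mulmx0 subr0 -scalemxAl.
  by rewrite addrAC subrK -scalerBr [RHS]mxE.
apply: mx_inD; last exact: mx_inMr.
apply: mx_inMr => k l; have := TP k l.
by rewrite !mxE [_ * s]mulrC.
Qed.

(** Four regular elements would allow four steps down, from degree 3 modulo
    nothing to degree 0 modulo three elements, where cohomology vanishes.  Then
    the dual of d3 would be onto, that is, d3 would have a left inverse. *)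
Lemma regular_sequence_size s :
    regular_sequence_in I s -> (forall h : 'M_(r3, r2), h *m d3 <> 1%:M) ->
  (size s <= 3)%N.
Proof.
move=> [sI [reg _]] no_split; rewrite leqNgt; apply/negP => s4.
pose J j := take j s.
have JS j : (j < 4)%N -> J j.+1 = rcons (J j) s`_j.
  by move=> j4; rewrite /J (take_nth 0) // (leq_trans j4).
have Jreg j : (j < 4)%N -> forall x, in_ideal (J j) (s`_j * x) -> in_ideal (J j) x.
  by move=> j4; apply: reg; apply: leq_trans s4.
have Jh j : (j < 4)%N -> in_ideal I s`_j.
  by move=> j4; apply/sI/mem_nth/(leq_trans j4).
have H0 : forall v : 'rV_1, mx_in (J 3) (v *m d1) ->
    exists w : 'rV_0, mx_in (J 3) (v - w *m (0 : 'M_(0, 1))).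
  move=> v vJ; exists 0; rewrite mulmx0 subr0 => i j.
  apply: (Jreg 3) => //; have [h0 [_ [_ [e _ _ _]]]] := resolution_homotopy (Jh 3 isT).
  have := mx_inMr h0 vJ; rewrite -mulmxA e mul_mx_scalar => /(_ i j).
  by rewrite mxE.
have H1 : forall v : 'rV_r1, mx_in (J 2) (v *m d2) ->
    exists w : 'rV_1, mx_in (J 2) (v - w *m d1).
  have [h0 [h1 [_ [_ e _ _]]]] := resolution_homotopy (Jh 2 isT).
  by apply: (cohomology_step (mul0mx 0 d1) e (Jreg 2 isT)); rewrite -JS.
have H2 : forall v : 'rV_r2, mx_in (J 1) (v *m d3) ->
    exists w : 'rV_r1, mx_in (J 1) (v - w *m d2).
  have [h0 [h1 [h2 [_ _ e _]]]] := resolution_homotopy (Jh 1 isT).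
  by apply: (cohomology_step resolution_d12 e (Jreg 1 isT)); rewrite -JS.
have H3 : forall v : 'rV_r3, exists w : 'rV_r2, mx_in (J 0) (v - w *m d3).
  have [h0 [h1 [h2 [_ _ _ e]]]] := resolution_homotopy (Jh 0 isT).
  move=> v; apply: (cohomology_step (d' := 0 :> 'M_(r3, 0)) (h := h2) (h' := 0) resolution_d23 _ (Jreg 0 isT)).
  - by rewrite mul0mx addr0 e.
  - by rewrite -JS.
  - by move=> i [].
have /choice[f fP] : forall i, exists w : 'rV_r2, mx_in (J 0) (delta_mx 0 i - w *m d3).
  by move=> i; apply: H3.
apply: (no_split (\matrix_i f i)); apply/row_matrixP => i.
rewrite row_mul rowK row1; apply/matrixP => k j.
have := fP i k j; rewrite /J take0 => /in_ideal_nil /eqP.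
by rewrite !mxE subr_eq0 => /eqP.
Qed.

End Resolutions.

(** * Projective dimension *)

Lemma linear_pack (R : pzRingType) (U V : lmodType R) (f : U -> V) :
  linear f -> exists F : {linear U -> V}, forall x, F x = f x.
Proof.
move=> lf; pose mix := GRing.isLinear.Build R U V *:%R f lf.
by exists (HB.pack_for {linear U -> V} f mix).
Qed.

Section ImageModule.
Variables (R : comNzRingType) (M N : lmodType R) (f : {linear M -> N}).

(** Projectivity lifts along surjections only; to lift along a map with the right
    image, its image has to be a module in its own right. *)
Definition image_pred : {pred N} := fun y => `[< exists x, f x = y >].

Lemma image_submod_closed : submod_closed image_pred.
Proof.
split=> [|a u v /asboolP[x <-] /asboolP[y <-]]; apply/asboolP.
  by exists 0; rewrite linear0.
by exists (a *: x + y); rewrite linearP.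
Qed.

HB.instance Definition _ :=
  GRing.isSubmodClosed.Build R N image_pred image_submod_closed.

Record image_module := ImageModule { image_val : N; _ : image_val \in image_pred }.

HB.instance Definition _ := [isSub for image_val].
HB.instance Definition _ := [Choice of image_module by <:].
HB.instance Definition _ := [SubChoice_isSubLmodule of image_module by <:].

End ImageModule.

Section Projective.
Variable R : comNzRingType.

Lemma projective_lift (P M N : lmodType R) (f : {linear M -> N}) (g : {linear P -> N}) :
    projective_module P -> (forall x, exists y, f y = g x) ->
  exists h : {linear P -> M}, forall x, f (h x) = g x.
Proof.
move=> prP fg.
have fI x : f x \in image_pred f by apply/asboolP; exists x.
have gI x : g x \in image_pred f by apply/asboolP; case: (fg x) => y; exists y.
have [|F FE] := @linear_pack R M (image_module f) (fun x => ImageModule (fI x)).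
  by move=> a x y; apply: val_inj; rewrite /= linearP.
have [|G GE] := @linear_pack R P (image_module f) (fun x => ImageModule (gI x)).
  by move=> a x y; apply: val_inj; rewrite /= linearP.
have [|h hE] := prP _ _ F G.
  by case=> y yI; have /asboolP[x xy] := yI; exists x; apply: val_inj; rewrite FE.
by exists h => x; have /(congr1 val) := hE x; rewrite FE GE.
Qed.

Lemma projective_cV n : projective_module 'cV[R]_n.
Proof.
move=> M N f g f_surj.
have /choice[y yP] : forall i : 'I_n, exists x, f x = g (delta_mx i 0) by move=> i.
have [|h hE] := @linear_pack R 'cV[R]_n M (fun v => \sum_i v i 0 *: y i).
  move=> a u v; rewrite scaler_sumr -big_split; apply: eq_bigr => i _.
  by rewrite !mxE scalerDl scalerA.
exists h => v; rewrite hE linear_sum [v in RHS]matrix_sum_delta linear_sum.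
apply: eq_bigr => i _; rewrite big_ord1 !linearZ /= yP //.
Qed.

End Projective.

Section ProjectiveDimension.
Variables (R : comNzRingType) (I : seq R) (r1 r2 r3 : nat).
Variables (d1 : 'M[R]_(1, r1)) (d2 : 'M[R]_(r1, r2)) (d3 : 'M[R]_(r2, r3)).
Hypothesis resI : free_resolution I d1 d2 d3.

Lemma cyclic_proj_surj (y : cyclic_module I) : exists x, cyclic_proj I x = y.
Proof. by eexists; apply: cyclic_projK. Qed.

Lemma cyclic_proj_linear :
  exists e : {linear 'cV[R]_1 -> cyclic_module I}, forall v, e v = cyclic_proj I (v 0 0).
Proof.
apply: linear_pack => a u v /=.
by rewrite !mxE cyclic_projD; congr (_ + _); rewrite -cyclic_scaleE.
Qed.

Lemma augmentation_exact (v : 'cV[R]_1) :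
  cyclic_proj I (v 0 0) = 0 <-> exists w : 'cV_r1, v = d1 *m w.
Proof.
have [H _ _ _] := resI; rewrite H.
have -> : (v 0 0)%:M = v by apply/matrixP => i j; rewrite !ord1 mxE eqxx mulr1n.
by [].
Qed.

Lemma resolution_projective_dimension_le :
  projective_dimension_le (cyclic_module I : lmodType R) 3.
Proof.
have [e eE] := cyclic_proj_linear; have [_ ex1 ex2 inj3] := resI.
pose r i := nth 0%N [:: 1%N; r1; r2; r3] i.
pose d i : 'M[R]_(r i, r i.+1) :=
  match i with 0 => d1 | 1 => d2 | 2 => d3 | _ => 0 end.
exists (fun i => 'cV[R]_(r i) : lmodType R), (fun i => mulmx (d i)), e; split.
- by move=> i; apply: projective_cV.
- move=> [|[|[|[|i]]]] // _ x; apply/matrixP => j; exfalso.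
  by move: j; rewrite /r /= nth_nil => -[].
- by move=> y; have [x <-] := cyclic_proj_surj y; exists x%:M; rewrite eE mxE eqxx mulr1n.
- by move=> x; rewrite eE; apply: augmentation_exact.
- move=> [|[|[|i]]] x /=; first exact: ex1; first exact: ex2.
  + split=> [/inj3->|[y ->]]; first by exists 0; rewrite mulmx0.
    by rewrite mul0mx mulmx0.
  + split=> _; last by rewrite mul0mx.
    exists 0; rewrite mulmx0; apply/matrixP => j; exfalso.
    by move: j; rewrite /r /= nth_nil => -[].
Qed.

(** Compare the free resolution with a projective one vanishing in degree 3, in
    both directions: the composite endomorphism a then b is homotopic to the
    identity and vanishes in degree 3, and the last homotopy h2 becomes a left
    inverse of d3. *)
Lemma resolution_projective_dimension_ge d :
    projective_dimension_le (cyclic_module I : lmodType R) d ->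
    (forall h : 'M_(r3, r2), h *m d3 <> 1%:M) ->
  (3 <= d)%N.
Proof.
move=> [P [f [e [prP Pd e_surj e_ex f_ex]]]] no_split; rewrite leqNgt; apply/negP => d3lt.
have P30 (x : P 3) : x = 0 by apply: Pd.
have [q qE] := cyclic_proj_linear.
have q_surj y : exists x, q x = y.
  by have [x <-] := cyclic_proj_surj y; exists x%:M; rewrite qE mxE eqxx mulr1n.
have q_ex v : q v = 0 <-> exists w : 'cV_r1, v = d1 *m w by rewrite qE; apply: augmentation_exact.
have [_ ex1 ex2 inj3] := resI.
have d12 := resolution_d12 resI; have d23 := resolution_d23 resI.
have ef x : e (f 0 x) = 0 by apply/e_ex; exists x.
have ff i x : f i (f i.+1 x) = 0 by apply/f_ex; exists x.
pose D1 : {linear 'cV[R]_r1 -> 'cV[R]_1} := mulmx d1.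
pose D2 : {linear 'cV[R]_r2 -> 'cV[R]_r1} := mulmx d2.
pose D3 : {linear 'cV[R]_r3 -> 'cV[R]_r2} := mulmx d3.
have DD1 x : D1 (D2 x) = 0 by rewrite /= mulmxA d12 mul0mx.
have DD2 x : D2 (D3 x) = 0 by rewrite /= mulmxA d23 mul0mx.
have qD x : q (D1 x) = 0 by apply/q_ex; exists x.
have [a0 a0E] := projective_lift (f := e) (g := q) (@projective_cV R 1) (fun x => e_surj (q x)).
have [a1 a1E] : exists a1 : {linear 'cV[R]_r1 -> P 1}, forall x, f 0 (a1 x) = a0 (D1 x).
  apply: (projective_lift (g := a0 \o D1)) => [|x]; first exact: projective_cV.
  have /e_ex[y yE] : e (a0 (D1 x)) = 0 by rewrite a0E qD.
  by exists y.
have [a2 a2E] : exists a2 : {linear 'cV[R]_r2 -> P 2}, forall x, f 1 (a2 x) = a1 (D2 x).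
  apply: (projective_lift (g := a1 \o D2)) => [|x]; first exact: projective_cV.
  have /f_ex[y yE] : f 0 (a1 (D2 x)) = 0 by rewrite a1E DD1 linear0.
  by exists y.
(* P 3 = 0 makes the differential out of P 2 injective. *)
have a2D3 x : a2 (D3 x) = 0.
  have /f_ex[y ->] : f 1 (a2 (D3 x)) = 0 by rewrite a2E DD2 linear0.
  by rewrite (P30 y) linear0.
have [b0 b0E] := projective_lift (f := q) (g := e) (prP 0) (fun x => q_surj (e x)).
have [b1 b1E] : exists b1 : {linear P 1 -> 'cV[R]_r1}, forall x, D1 (b1 x) = b0 (f 0 x).
  apply: (projective_lift (g := b0 \o f 0)) => [|x]; first exact: prP.
  have /q_ex[y yE] : q (b0 (f 0 x)) = 0 by rewrite b0E ef.
  by exists y.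
have [b2 b2E] : exists b2 : {linear P 2 -> 'cV[R]_r2}, forall x, D2 (b2 x) = b1 (f 1 x).
  apply: (projective_lift (g := b1 \o f 1)) => [|x]; first exact: prP.
  have /ex1[y yE] : D1 (b1 (f 1 x)) = 0 by rewrite b1E ff linear0.
  by exists y.
have [h0 h0E] : exists h0 : {linear 'cV[R]_1 -> 'cV[R]_r1}, forall x, D1 (h0 x) = x - b0 (a0 x).
  apply: (projective_lift (g := idfun \- (b0 \o a0))) => [|x]; first exact: projective_cV.
  have /q_ex[y yE] : q (x - b0 (a0 x)) = 0 by rewrite linearB b0E a0E subrr.
  by exists y.
have [h1 h1E] : exists h1 : {linear 'cV[R]_r1 -> 'cV[R]_r2},
    forall x, D2 (h1 x) = x - b1 (a1 x) - h0 (D1 x).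
  apply: (projective_lift (g := idfun \- (b1 \o a1) \- (h0 \o D1))) => [|x].
    exact: projective_cV.
  have /ex1[y yE] : D1 (x - b1 (a1 x) - h0 (D1 x)) = 0.
    by rewrite !(linearB D1) h0E b1E a1E opprB addrA subrK subrr.
  by exists y.
have [h2 h2E] : exists h2 : {linear 'cV[R]_r2 -> 'cV[R]_r3},
    forall x, D3 (h2 x) = x - b2 (a2 x) - h1 (D2 x).
  apply: (projective_lift (g := idfun \- (b2 \o a2) \- (h1 \o D2))) => [|x].
    exact: projective_cV.
  have /ex2[y yE] : D2 (x - b2 (a2 x) - h1 (D2 x)) = 0.
    by rewrite !(linearB D2) h1E b2E a2E DD1 linear0 subr0 subrr.
  by exists y.
have h2D3 x : h2 (D3 x) = x.
  apply: (resolution_cancel resI).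
  by rewrite [LHS]h2E a2D3 DD2 (linear0 b2) (linear0 h1) !subr0.
apply: (no_split (\matrix_(i, j) h2 (delta_mx j 0) i 0)).
apply/matrixP => i j.
have /matrixP/(_ i 0) := h2D3 (delta_mx j 0).
rewrite [RHS]mxE eqxx andbT => hij; rewrite [RHS]mxE -hij mxE.
rewrite -[D3 _]/(d3 *m _) -colE [col j d3]matrix_sum_delta linear_sum summxE.
by apply: eq_bigr => k _; rewrite big_ord1 linearZ !mxE mulrC.
Qed.

End ProjectiveDimension.

(** * Regular sequences from coprime leading monomials *)

Section LeadingMonomials.
Variables (n : nat) (K : comNzRingType) (wt : 'X_{1..n} -> nat).
Hypothesis wtD : forall m1 m2, wt (m1 + m2)%MM = (wt m1 + wt m2)%N.
Implicit Types (p q : {mpoly K[n]}) (mu nu : 'X_{1..n}).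

(** Weights instead of a monomial order: the weight has to separate the top term from
    the rest, but may tie lower terms with each other. *)
Definition below d p := forall mu, mu \in msupp p -> (wt mu < d)%N.
Definition leads mu p := below (wt mu) (p - 'X_[mu]).

Lemma below0 d : below d 0.
Proof. by move=> mu; rewrite msupp0. Qed.

Lemma belowW d e p : (d <= e)%N -> below d p -> below e p.
Proof. by move=> de pd mu /pd; lia. Qed.

Lemma belowD d p q : below d p -> below d q -> below d (p + q).
Proof. by move=> pd qd mu /msuppD_le; rewrite mem_cat => /orP[/pd|/qd]. Qed.

Lemma belowN d p : below d p -> below d (- p).
Proof. by move=> pd mu; rewrite (perm_mem (msuppN p)) => /pd. Qed.

Lemma belowB d p q : below d p -> below d q -> below d (p - q).
Proof. by move=> pd /belowN; apply: belowD. Qed.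

Lemma belowZ d c p : below d p -> below d (c *: p).
Proof. by move=> pd mu /msuppZ_le/pd. Qed.

Lemma belowX mu : below (wt mu).+1 'X_[mu].
Proof. by move=> nu; rewrite msuppX inE => /eqP->. Qed.

Lemma belowM d e p q : below d p -> below e.+1 q -> below (d + e) (p * q).
Proof.
move=> pd qe mu /msuppM_le/allpairsP[[m1 m2] /= [/pd H1 /qe H2 ->]].
by rewrite wtD; lia.
Qed.

Lemma below_sum (T : eqType) (s : seq T) (F : T -> {mpoly K[n]}) d :
  {in s, forall i, below d (F i)} -> below d (\sum_(i <- s) F i).
Proof.
move=> Fd; rewrite big_seq; apply: big_ind => //; first exact: below0.
exact: belowD.
Qed.

Lemma below_leads mu p : leads mu p -> below (wt mu).+1 p.
Proof.
move=> mp; rewrite -[p](subrK 'X_[mu]); apply: belowD; last exact: belowX.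
exact: belowW (leqnSn _) mp.
Qed.

Lemma leadsX mu : leads mu 'X_[mu].
Proof. by rewrite /leads subrr; apply: below0. Qed.

Lemma leadsM mu nu p q : leads mu p -> leads nu q -> leads (mu + nu) (p * q).
Proof.
move=> mp nq; rewrite /leads wtD mpolyXD.
have -> : p * q - 'X_[mu] * 'X_[nu] = (p - 'X_[mu]) * q + (q - 'X_[nu]) * 'X_[mu] by ring.
apply: belowD; first exact/belowM/below_leads.
by rewrite addnC; apply/belowM/belowX.
Qed.

Lemma leads_exp mu p k : leads mu p -> leads (mu *+ k)%MM (p ^+ k).
Proof.
move=> mp; elim: k => [|k IH]; first by rewrite mulm0n expr0 -mpolyX0; apply: leadsX.
by rewrite exprS mulmS; apply: leadsM.
Qed.

Lemma leads_prod (I : Type) (s : seq I) (E : I -> 'X_{1..n}) (F : I -> {mpoly K[n]}) :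
  (forall i, leads (E i) (F i)) -> leads (\sum_(i <- s) E i)%MM (\prod_(i <- s) F i).
Proof.
move=> EF; elim: s => [|i s IH]; first by rewrite !big_nil -mpolyX0; apply: leadsX.
by rewrite !big_cons; apply: leadsM.
Qed.

Variables (r : nat) (e : nat -> 'X_{1..n}) (f : nat -> {mpoly K[n]}).
Hypothesis e_neq0 : forall i, (i < r)%N -> exists k, e i k <> 0%N.
Hypothesis e_disj : forall i j k, (i < r)%N -> (j < r)%N -> i != j -> e i k = 0%N \/ e j k = 0%N.
Hypothesis ef : forall i, leads (e i) (f i).

(** The exponent of the i-th leading monomial in mu. *)
Definition valuation i mu : nat :=
  \max_(k < (mdeg mu).+1 | (e i *+ k <= mu)%MM) k.

Lemma valuationP i mu k : (i < r)%N -> (k <= valuation i mu)%N = (e i *+ k <= mu)%MM.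
Proof.
move=> ir; apply/idP/idP => [kv|kmu].
  have vP : (e i *+ valuation i mu <= mu)%MM.
    apply: (big_ind (fun v => (e i *+ v <= mu)%MM)) => [|a b aP bP|k' //]; last by rewrite /maxn; case: ifP.
    by apply/mnm_lepP => j; rewrite mulmnE muln0.
  by apply: lepm_trans vP; apply/mnm_lepP => j; rewrite !mulmnE leq_mul2l kv orbT.
have kmdeg : (k < (mdeg mu).+1)%N.
  have [l /eqP el] := e_neq0 ir; move/mnm_lepP/(_ l): kmu; rewrite mulmnE => kmu.
  have : (mu l <= mdeg mu)%N by rewrite mdegE (bigD1 l) //= leq_addr.
  by nia.
by rewrite /valuation (bigD1 (Ordinal kmdeg)) //= leq_maxl.
Qed.

Lemma eq_leq_all a b : (forall k, (k <= a)%N = (k <= b)%N) -> a = b.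
Proof. by move=> H; apply/eqP; rewrite eqn_leq -H leqnn H leqnn. Qed.

Lemma valuation_same i mu : (i < r)%N -> valuation i (mu + e i)%MM = (valuation i mu).+1.
Proof.
move=> ir; apply: eq_leq_all => -[|k]; first by rewrite !leq0n.
rewrite ltnS !valuationP //; apply/mnm_lepP/mnm_lepP => H j; move: (H j);
  by rewrite mnmDE !mulmnE mulnS; lia.
Qed.

Lemma valuation_other i j mu : (i < r)%N -> (j < r)%N -> i != j ->
  valuation j (mu + e i)%MM = valuation j mu.
Proof.
move=> ir jr ij; apply: eq_leq_all => k; rewrite !valuationP //.
apply/mnm_lepP/mnm_lepP => H l; move: (H l); rewrite mnmDE !mulmnE; last by lia.
by have [->|->] := e_disj l ir jr ij; rewrite ?addn0 // mul0n.
Qed.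

Definition divided mu : 'X_{1..n} := (\sum_(i < r) (e i *+ valuation i mu))%MM.

Lemma divided_le mu : (divided mu <= mu)%MM.
Proof.
apply/mnm_lepP => k; rewrite mnm_sumE.
have [/existsP[i ik]|/existsPn none] := boolP [exists i : 'I_r, e i k != 0%N]; last first.
  by rewrite big1 // => i _; rewrite mulmnE; move/negPn/eqP: (none i) => ->.
rewrite (bigD1 i) //= big1 ?addn0 => [|j ji]; last first.
  have [e0|e0] := e_disj k (ltn_ord j) (ltn_ord i) ji; first by rewrite mulmnE e0.
  by rewrite e0 eqxx in ik.
by have := leqnn (valuation i mu); rewrite valuationP // => /mnm_lepP/(_ k).
Qed.

Lemma divided_add i mu : (i < r)%N -> divided (mu + e i)%MM = (divided mu + e i)%MM.
Proof.
move=> ir; rewrite /divided (bigD1 (Ordinal ir)) //= valuation_same // mulmS.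
rewrite [in RHS](bigD1 (Ordinal ir)) //= [RHS]addmC addmA; congr (_ + _)%MM.
apply: eq_bigr => j ji; rewrite valuation_other //.
by apply: contraNneq ji => ij; apply/eqP/val_inj.
Qed.

(** Replace in mu every factor X^(e i) by f i.  Linearly extended, this turns
    multiplication by the monomial X^(e i) into multiplication by f i; as it is
    unitriangular for the weight, it is bijective.  Hence the f i form a regular
    sequence exactly as the coprime monomials do. *)
Definition twist_mon mu : {mpoly K[n]} :=
  'X_[(mu - divided mu)%MM] * \prod_(i < r) f i ^+ valuation i mu.

Lemma leads_twist_mon mu : leads mu (twist_mon mu).
Proof.
rewrite -{1}(submK (divided_le mu)); apply: leadsM; first exact: leadsX.
by apply: leads_prod => i; apply: leads_exp.
Qed.

(** Adding e i raises the i-th valuation by one and, by coprimality, changes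
    neither the other valuations nor the undivided part. *)
Lemma twist_mon_add i mu : (i < r)%N -> twist_mon (mu + e i)%MM = f i * twist_mon mu.
Proof.
move=> ir; rewrite /twist_mon divided_add //.
have -> : (mu + e i - (divided mu + e i) = mu - divided mu)%MM.
  by apply/mnmP => k; rewrite !mnmBE !mnmDE subnDr.
rewrite mulrCA; congr (_ * _).
rewrite (bigD1 (Ordinal ir)) //= [in RHS](bigD1 (Ordinal ir)) //= valuation_same // exprS -mulrA.
congr (_ * (_ * _)); apply: eq_bigr => j ji; rewrite valuation_other //.
by apply: contraNneq ji => ij; apply/eqP/val_inj.
Qed.

Definition twist p : {mpoly K[n]} := \sum_(mu <- msupp p) p@_mu *: twist_mon mu.

Lemma twist_sup p s : uniq s -> {subset msupp p <= s} ->
  twist p = \sum_(mu <- s) p@_mu *: twist_mon mu.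
Proof.
move=> us ps; rewrite [RHS](bigID (mem (msupp p))) /= [X in _ = _ + X]big1 ?addr0.
  rewrite -[RHS]big_filter; apply: perm_big; apply: uniq_perm.
  - exact: msupp_uniq.
  - exact: filter_uniq.
  - by move=> mu; rewrite mem_filter; case: (boolP (mu \in msupp p)) => // /ps ->.
by move=> mu /memN_msupp_eq0 ->; rewrite scale0r.
Qed.

Lemma twistD p q : twist (p + q) = twist p + twist q.
Proof.
pose s := undup (msupp p ++ msupp q).
rewrite !(@twist_sup _ s) ?undup_uniq //.
- by rewrite -big_split; apply: eq_bigr => mu _; rewrite mcoeffD scalerDl.
- by move=> mu; rewrite mem_undup mem_cat => ->; rewrite orbT.
- by move=> mu; rewrite mem_undup mem_cat => ->.
- by move=> mu /msuppD_le; rewrite mem_undup.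
Qed.

Lemma twistZX c mu : twist (c *: 'X_[mu]) = c *: twist_mon mu.
Proof.
rewrite (@twist_sup _ [:: mu]) //; last by move=> nu /msuppZ_le; rewrite msuppX.
by rewrite big_seq1 mcoeffZ mcoeffX eqxx mulr1.
Qed.

Lemma twist0 : twist 0 = 0.
Proof. by rewrite /twist msupp0 big_nil. Qed.

Lemma twist_sum (T : Type) (s : seq T) (F : T -> {mpoly K[n]}) :
  twist (\sum_(i <- s) F i) = \sum_(i <- s) twist (F i).
Proof. exact: (big_morph _ twistD twist0). Qed.

Lemma twistM i p : (i < r)%N -> twist (p * 'X_[e i]) = f i * twist p.
Proof.
move=> ir; rewrite {1}[p]mpolyE mulr_suml twist_sum mulr_sumr.
apply: eq_bigr => mu _.
by rewrite -scalerAl -mpolyXD twistZX twist_mon_add // scalerAr.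
Qed.

Lemma twist_below d p : below d.+1 p -> below d (twist p - p).
Proof.
move=> pd; rewrite {2}[p]mpolyE -sumrB; apply: below_sum => mu mup.
rewrite -scalerBr; apply: belowZ; apply: belowW; last exact: leads_twist_mon.
exact: pd.
Qed.

Lemma below_bound p : exists d, below d p.
Proof.
exists (\max_(mu <- msupp p) wt mu).+1 => mu mup.
by rewrite ltnS (leq_bigmax_seq _ mup).
Qed.

Lemma below_eq0 p : below 0 p -> p = 0.
Proof.
move=> p0; rewrite [p]mpolyE big_seq big1 // => mu /p0; lia.
Qed.

Lemma twist_inj0 p : twist p = 0 -> p = 0.
Proof.
move=> tp; apply: below_eq0; have [d] := below_bound p.
elim: d => // d IH /twist_below; rewrite tp sub0r => /belowN; rewrite opprK.
exact: IH.
Qed.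

Lemma twist_inj : injective twist.
Proof.
move=> p q pq; apply/eqP; rewrite -subr_eq0; apply/eqP/twist_inj0.
by apply: (addIr (twist q)); rewrite -twistD subrK add0r.
Qed.

Lemma twist_surj p : exists q, twist q = p.
Proof.
have [d] := below_bound p; elim: d p => [|d IH] p pd.
  by exists 0; rewrite twist0 (below_eq0 pd).
have [q qE] := IH _ (belowN (twist_below pd)).
by exists (q + p); rewrite twistD qE opprB subrK.
Qed.

(** A monomial of p times X^(e i) is divisible by some X^(e j) with j < i, hence
    so is the monomial itself. *)
Lemma monomial_regular i p (c : nat -> {mpoly K[n]}) : (i < r)%N ->
    p * 'X_[e i] = \sum_(j < i) c j * 'X_[e j] ->
  exists b : nat -> {mpoly K[n]}, p = \sum_(j < i) b j * 'X_[e j].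
Proof.
move=> ir pc; pose Q p := exists b : nat -> {mpoly K[n]}, p = \sum_(j < i) b j * 'X_[e j].
rewrite -/(Q p) [p]mpolyE big_seq; apply: big_ind => [|p1 p2 [b1 ->] [b2 ->]|mu mup].
- by exists (fun=> 0); rewrite big1 // => j _; rewrite mul0r.
- exists (fun j => b1 j + b2 j); rewrite -big_split; apply: eq_bigr => j _.
  by rewrite mulrDl.
have [/existsP[j ejmu]|/existsPn none] := boolP [exists j : 'I_i, (e j <= mu)%MM].
  exists (fun k : nat => if k == j :> nat then p@_mu *: 'X_[(mu - e j)%MM] else 0).
  rewrite (bigD1 j) //= eqxx big1 ?addr0 => [|k kj]; last by rewrite -val_eqE in kj; rewrite (negPf kj) mul0r.
  by rewrite -scalerAl -mpolyXD submK.
have : (p * 'X_[e i])@_(e i + mu) = 0.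
  rewrite pc raddf_sum big1 // => j _ /=; apply: memN_msupp_eq0; apply/negP.
  move/msuppM_le/allpairsP => [[m1 m2] /= [_]]; rewrite msuppX inE => /eqP -> E.
  move/negP: (none j); apply; apply/mnm_lepP => k.
  have := congr1 (fun m : 'X_{1..n} => m k) E; rewrite !mnmDE.
  have ji : i != j :> nat by rewrite neq_ltn ltn_ord orbT.
  by have [->|->] := e_disj k ir (ltn_trans (ltn_ord j) ir) ji; lia.
rewrite mcoeffMX => p0; exists (fun=> 0).
by rewrite p0 scale0r big1 // => j _; rewrite mul0r.
Qed.

Lemma leads_regular i p (c : nat -> {mpoly K[n]}) : (i < r)%N ->
    f i * p = \sum_(j < i) c j * f j ->
  exists b : nat -> {mpoly K[n]}, p = \sum_(j < i) b j * f j.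
Proof.
move=> ir; have [q <-] := twist_surj p.
have /choice[d dE] : forall j, exists q, twist q = c j by move=> j; apply: twist_surj.
have tsum (b : nat -> {mpoly K[n]}) :
    twist (\sum_(j < i) b j * 'X_[e j]) = \sum_(j < i) twist (b j) * f j.
  rewrite twist_sum; apply: eq_bigr => j _.
  by rewrite twistM ?(ltn_trans (ltn_ord j)) // mulrC.
move=> E; have [|b ->] := @monomial_regular i q d ir.
  apply: twist_inj; rewrite tsum twistM // E.
  by apply: eq_bigr => j _; rewrite dE.
by exists (fun j => twist (b j)); rewrite tsum.
Qed.

End LeadingMonomials.

(** * Leading monomials of generic Pfaffians *)

Lemma sign_cancel (R : comNzRingType) a b (c x p : R) :
  (-1) ^+ a * (-1) ^+ b * c * ((-1) ^+ a * ((-1) ^+ b * x * p)) = x * (c * p).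
Proof.
transitivity (((-1) ^+ a) ^+ 2 * ((-1) ^+ b) ^+ 2 * (x * (c * p))).
  by move: (_ ^+ a) (_ ^+ b) => u v; ring.
by rewrite !sqrr_sign !mul1r.
Qed.

Section GenericPfaffians.
Variables (K : comNzRingType) (m : nat).
Local Notation N := (2 * m)%N.
Local Notation vertex := ('I_3 + 'I_N)%type.
Local Notation A := (generic_A K m).
Local Notation B := (generic_B K m).
Local Notation pfg := (pfw (border B A)).
Implicit Types (x y : vertex) (v : var m) (mu : 'X_{1..#|var m|}).

Definition ends v : vertex * vertex :=
  match v with
  | inl p => (inr (val p).1, inr (val p).2)
  | inr (k, i) => (inl k, inr i)
  end.

Lemma generic_AE (i j : 'I_N) : (i < j)%N ->
  exists2 v : var m, A i j = gvar K v /\ A j i = - gvar K v & ends v = (inr i, inr j).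
Proof.
move=> ij; pose p : cvar m := Sub (i, j) ij.
have ins : insub (i, j) = Some p by rewrite insubT.
have ins' : insub (j, i) = None :> option (cvar m) by rewrite insubN //= -leqNgt ltnW.
by exists (inl p); first by rewrite !mxE ins ins'.
Qed.

Lemma generic_A0 i : A i i = 0.
Proof. by rewrite !mxE !insubN //= ltnn. Qed.

Lemma generic_AN i j : A i j = - A j i.
Proof.
case: (ltngtP i j) => [/generic_AE[v [-> ->] _]|/generic_AE[v [-> ->] _]|/val_inj->].
- by rewrite opprK.
- by [].
- by rewrite generic_A0 oppr0.
Qed.

Definition both_inl x y := is_inl x && is_inl y.

(** Off the border block and the diagonal, the entries are distinct variables up to
    sign. *)
Lemma border_var x y : x != y -> ~~ both_inl x y ->
  exists (b : bool) v, border B A x y = (-1) ^+ b * gvar K v /\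
    (ends v = (x, y) \/ ends v = (y, x)).
Proof.
case: x y => [k|i] [l|j] //= xy _.
- by exists false, (inr (k, j)); rewrite mxE mul1r; split=> //; left.
- by exists true, (inr (l, i)); rewrite mxE mulN1r; split=> //; right.
have {xy} : i != j by apply: contraNneq xy => ->.
rewrite neq_ltn => /orP[] /generic_AE[v [e1 e2] ev].
- by exists false, v; rewrite e1 mul1r; split=> //; left.
- by exists true, v; rewrite e2 mulN1r; split=> //; right.
Qed.

Definition mwt (w : var m -> nat) mu : nat := (\sum_v mu (enum_rank v) * w v)%N.

Lemma mwtD w mu nu : mwt w (mu + nu)%MM = (mwt w mu + mwt w nu)%N.
Proof. by rewrite -big_split; apply: eq_bigr => v _; rewrite mnmDE mulnDl. Qed.

Lemma mwt_var w v : mwt w U_(enum_rank v)%MM = w v.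
Proof.
rewrite /mwt (bigD1 v) //= mnm1E eqxx mul1n big1 ?addn0 // => u uv.
by rewrite mnm1E (inj_eq enum_rank_inj) eq_sym (negPf uv).
Qed.

Lemma msupp_signM (b : nat) (p : gring K m) : msupp ((-1) ^+ b * p) =i msupp p.
Proof.
move=> mu; rewrite -signr_odd; case: odd; rewrite ?mul1r // mulN1r.
exact: perm_mem (msuppN p) mu.
Qed.

Lemma msupp_border x y mu : mu \in msupp (border B A x y) ->
  exists2 v, mu = U_(enum_rank v)%MM & ends v = (x, y) \/ ends v = (y, x).
Proof.
have [->|xy] := eqVneq x y; first by rewrite border0 ?msupp0 //; apply: generic_A0.
have [|/(border_var xy)[b [v [-> ev]]]] := boolP (both_inl x y).
  by case: x y xy => [k|i] [l|j] //= _ _; rewrite msupp0.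
by rewrite msupp_signM msuppX inE => /eqP ->; exists v.
Qed.

Definition homogeneous_of (w : var m -> nat) (d : nat) (p : gring K m) :=
  forall mu, mu \in msupp p -> mwt w mu = d.

Lemma pfg_homogeneous w (al : vertex -> nat) s :
    (forall v, w v = al (ends v).1 + al (ends v).2)%N ->
  homogeneous_of w (\sum_(x <- s) al x)%N (pfg s).
Proof.
move=> wal; apply: pfw_closed.
- by move=> d mu; rewrite msupp0.
- by move=> d p q pd qd mu /msuppB_le; rewrite mem_cat => /orP[/pd|/qd].
- move=> d e p q pd qe mu /msuppM_le/allpairsP[[m1 m2] /= [/pd H1 /qe H2 ->]].
  by rewrite mwtD H1 H2.
- by move=> mu; rewrite msupp1 inE => /eqP->; rewrite /mwt big1 // => v _; rewrite mnm0E.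
move=> x y _ _ mu /msupp_border[v -> ev]; rewrite mwt_var wal.
by case: ev => -> /=; rewrite // addnC.
Qed.

Local Notation c := m.+1.

(** The vertices in a linear order with 1' first, 2' in the middle and 3' last.
    In this order deleting 3', deleting 1', and deleting all three leave words
    whose nested matchings consist of edges of constant position sum 2c-1, 2c+1
    and 2c respectively: three disjoint antidiagonals. *)
Definition pos x : nat :=
  match x with inl k => k * c | inr i => if (i < m)%N then i.+1 else i.+2 end.

Lemma pos_le x : (pos x <= 2 * c)%N.
Proof.
case: x => [k|i] /=; first by have := ltn_ord k; nia.
by have := ltn_ord i; case: ifP => _; lia.
Qed.

Definition possum v : nat := pos (ends v).1 + pos (ends v).2.
(** A strictly concave function of the position sum; concavity makes the edges of
    equal sums the heaviest matching. *)
Definition varwt v : nat := (2 * possum v * (4 * c + 2 - possum v))%N.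
Local Notation wt := (mwt varwt).
Local Notation below := (below wt).
Local Notation leads := (leads wt).

(** The tangent line of the weight at s0, split between the two end points, so
    that its total over a perfect matching does not depend on the matching. *)
Definition potential (s0 : nat) x : nat := s0 * s0 + (8 * c + 4 - 4 * s0) * pos x.

(** The tangent exceeds the concave weight by twice the square of the distance
    from s0, written without subtraction. *)
Lemma varwt_potential s0 v : (s0 <= 2 * c + 1)%N ->
  (varwt v + 2 * (possum v * possum v + s0 * s0) =
   potential s0 (ends v).1 + potential s0 (ends v).2 + 4 * (possum v * s0))%N.
Proof.
move=> s0c; have := pos_le (ends v).1; have := pos_le (ends v).2.
rewrite /varwt /potential /possum; move: (pos _) (pos _) => a b a2 b2.
have [d dE] : exists d, (2 * c + 1 = s0 + d)%N by exists (2 * c + 1 - s0)%N; lia.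
have -> : (8 * c + 4 - 4 * s0 = 4 * d)%N by lia.
have [t tE] : exists t, (4 * c + 2 = a + b + t)%N by exists (4 * c + 2 - (a + b))%N; lia.
have -> : (4 * c + 2 - (a + b) = t)%N by lia.
have {tE dE} : (a + b + t = 2 * s0 + 2 * d)%N by lia.
move=> st.
have : ((a + b) * t + (a + b) * (a + b) = 2 * ((a + b) * s0) + 2 * ((a + b) * d))%N.
  by rewrite -mulnDr [(t + _)%N]addnC st; lia.
lia.
Qed.

Lemma varwt_lt s0 v : (s0 <= 2 * c + 1)%N -> possum v != s0 ->
  (varwt v < potential s0 (ends v).1 + potential s0 (ends v).2)%N.
Proof. by move=> s0c; have := varwt_potential v s0c; move: (possum v) => s; nia. Qed.

Lemma varwt_eq s0 v : (s0 <= 2 * c + 1)%N -> possum v = s0 ->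
  varwt v = (potential s0 (ends v).1 + potential s0 (ends v).2)%N.
Proof. by move=> s0c vs; have := varwt_potential v s0c; rewrite vs; lia. Qed.

Lemma border_below s0 x y : (s0 <= 2 * c + 1)%N ->
  below (potential s0 x + potential s0 y + (pos x + pos y == s0)%N)%N (border B A x y).
Proof.
move=> s0c mu /msupp_border[v -> ev]; rewrite mwt_var.
have [pe pp] : (potential s0 x + potential s0 y =
    potential s0 (ends v).1 + potential s0 (ends v).2)%N /\ (pos x + pos y = possum v)%N.
  by rewrite /possum; case: ev => ->; split=> //; rewrite addnC.
rewrite pe pp; have [/(varwt_eq s0c)->|/(varwt_lt s0c)] := eqVneq (possum v) s0.
  by rewrite addn1.
by rewrite addn0.
Qed.

Lemma pfg_below s0 s : (s0 <= 2 * c + 1)%N ->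
  below (\sum_(x <- s) potential s0 x).+1 (pfg s).
Proof.
move=> s0c; apply: (pfw_closed (P := fun d => below d.+1)).
- by move=> d; apply: below0.
- by move=> d p q; apply: belowB.
- by move=> d e p q; apply: (belowM (@mwtD varwt)).
- by move=> mu; rewrite msupp1 inE => /eqP->; rewrite /mwt big1 // => v _; rewrite mnm0E.
move=> x y _ _; have := @border_below s0 x y s0c; apply: belowW.
by case: eqP => _; rewrite ?addn1 ?addn0.
Qed.

(** The leading term is the nested matching.  The first letter x has exactly one
    partner at the tangency sum, the last letter y; every other edge at x is
    strictly below its potential, and removing x and y leaves a word of the same
    kind.  The gap between p and q leaves room for the omitted middle vertex. *)
Lemma pfg_leads p q k s : (k <= p)%N -> (p <= q)%N -> (p + q <= 2 * c + 2)%N ->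
    map pos s = iota (p - k) k ++ iota q k ->
    {in s &, forall x y, (pos x + pos y = (p + q).-1)%N -> ~~ both_inl x y} ->
  exists (b : nat) e, [/\ leads e ((-1) ^+ b * pfg s),
     mwt varwt e = (\sum_(x <- s) potential (p + q).-1 x)%N,
     forall v, e (enum_rank v) <> 0%N -> possum v = (p + q).-1
   & (0 < k)%N -> exists i, e i <> 0%N].
Proof.
set s0 := (p + q).-1 => kp pq pqc.
have s0c : (s0 <= 2 * c + 1)%N by rewrite /s0; lia.
elim: k s kp => [|k IH] s kp.
  case: s => // _ _; exists 0%N, 0%MM; split=> //.
  - by rewrite mul1r pfw_nil -mpolyX0; apply: leadsX.
  - by rewrite big_nil /mwt big1 // => v _; rewrite mnm0E.
  - by move=> v; rewrite mnm0E.
rewrite -[in iota q _]addn1 iotaD /= catA.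
case: s => [|x s] //=; case/lastP: s => [|t y].
  by move=> /(congr1 size); rewrite /= !size_cat /= !size_iota; lia.
rewrite map_rcons cats1 => -[xE /rcons_inj[tE yE]] ninl.
have pk : ((p - k.+1).+1 = p - k)%N by lia.
have {}tE : map pos t = iota (p - k) k ++ iota q k by rewrite tE -pk.
have xys0 : (pos x + pos y = s0)%N by rewrite xE yE /s0; lia.
have tlt z : z \in t -> (pos z < pos y)%N.
  by move=> zt; have := map_f pos zt; rewrite tE mem_cat !mem_iota yE; lia.
have [|b' [e' [lead' wt' sum' _]]] := IH t (ltnW kp) tE.
  by move=> z1 z2 z1t z2t; apply: ninl; rewrite inE mem_rcons inE ?z1t ?z2t !orbT.
have xs : x \in x :: rcons t y by rewrite inE eqxx.
have ys : y \in x :: rcons t y by rewrite inE mem_rcons inE eqxx orbT.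
have xy : x != y by apply/eqP => xy; move: xys0 yE xE; rewrite xy; lia.
have [b [v [vE ev]]] := border_var xy (ninl x y xs ys xys0).
have vs0 : possum v = s0 by rewrite /possum; case: ev => ->; rewrite //= addnC.
have wtv : varwt v = (potential s0 x + potential s0 y)%N.
  by rewrite (varwt_eq s0c vs0); case: ev => ->; rewrite //= addnC.
have sumE : (varwt v + \sum_(z <- t) potential s0 z = \sum_(z <- x :: rcons t y) potential s0 z)%N.
  by rewrite big_cons -cats1 big_cat big_seq1 wtv /=; lia.
have eT : mwt varwt (U_(enum_rank v) + e') = (\sum_(z <- x :: rcons t y) potential s0 z)%N.
  by rewrite mwtD mwt_var wt' sumE.
exists (size t + b + b')%N, (U_(enum_rank v) + e')%MM; split=> //.
- rewrite pfw_cons -cats1 contract_cat /= subr0 cats0 mulrDr vE.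
  set C := contract _ _ t.
  have -> : (-1) ^+ (size t + b + b') * ((-1) ^+ size t * ((-1) ^+ b * gvar K v * pfg t))
      = 'X_[U_(enum_rank v)] * ((-1) ^+ b' * pfg t).
    by rewrite !exprD sign_cancel.
  rewrite /leads -addrA addrC; apply: belowD.
    exact: (leadsM (@mwtD varwt) (@leadsX _ _ wt U_(enum_rank v)%MM) lead').
  move=> mu; rewrite msupp_signM eT; move: mu.
  apply: (contract_closed (P := below _)); [exact: below0 | exact: belowB|].
  move=> l w r tE'; rewrite -catA.
  have wt_t : w \in t by rewrite tE' mem_cat inE eqxx orbT.
  have -> : (\sum_(z <- x :: rcons t y) potential s0 z = potential s0 x + potential s0 w +
      \sum_(z <- l ++ r ++ [:: y]) potential s0 z)%N.
    by rewrite tE' big_cons -cats1 -!catA !big_cat big_cons !big_seq1 /=; lia.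
  apply: (belowM (@mwtD varwt)); last exact: pfg_below.
  have := @border_below s0 x w s0c; rewrite [(_ == s0)](_ : _ = false) ?addn0 //.
  by apply/eqP; have := tlt w wt_t; lia.
- move=> u; rewrite mnmDE mnm1E (inj_eq enum_rank_inj).
  by have [<- //|_] := eqVneq v u; apply: sum'.
- by move=> _; exists (enum_rank v); rewrite mnmDE mnm1E eqxx.
Qed.

End GenericPfaffians.

(** * Exactness of the generic complex *)

Section GenericResolution.
Variables (K : comNzRingType) (m : nat).
Hypothesis m_gt0 : (0 < m)%N.
Local Notation N := (2 * m)%N.
Local Notation vertex := ('I_3 + 'I_N)%type.
Local Notation A := (generic_A K m).
Local Notation B := (generic_B K m).
Local Notation g := (enum 'I_N).
Local Notation c := m.+1.

Let alt := alternating_pfw (@borderN _ _ B A (@generic_AN K m)) (@border0 _ _ B A (@generic_A0 K m)).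

Definition lowg : seq vertex := map inr (take m g).
Definition highg : seq vertex := map inr (drop m g).

Lemma lowg_highg : map inr g = lowg ++ highg.
Proof. by rewrite -map_cat cat_take_drop. Qed.

Lemma pos_enum : map (@pos m) (map inr g) = iota 1 m ++ iota (m + 2) m.
Proof.
have -> : map (@pos m) (map inr g) = map (fun i => if i < m then i.+1 else i.+2)%N (iota 0 N).
  by rewrite -val_enum_ord -!map_comp.
have -> : N = (m + m)%N by lia.
rewrite iotaD map_cat; congr (_ ++ _).
  rewrite (iotaDl 1 0 m); apply/eq_in_map => i; rewrite mem_iota => /andP[_ im].
  by rewrite im.
rewrite add0n (addnC m 2) (iotaDl 2 m m); apply/eq_in_map => i; rewrite mem_iota => /andP[im _].
by rewrite ltnNge im.
Qed.

Lemma pos_lowg : map (@pos m) lowg = iota 1 m.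
Proof.
by rewrite /lowg !map_take pos_enum take_size_cat // size_iota.
Qed.

Lemma pos_highg : map (@pos m) highg = iota (m + 2) m.
Proof.
by rewrite /highg !map_drop pos_enum drop_size_cat // size_iota.
Qed.

Lemma leads_of_word (s : seq vertex) (p q k : nat) (f : gring K m) (b0 : nat) :
    (0 < k <= p)%N -> (p <= q)%N -> (p + q <= 2 * c + 2)%N ->
    map (@pos m) s = iota (p - k) k ++ iota q k ->
    {in s &, forall x y, (pos x + pos y = (p + q).-1)%N -> ~~ both_inl x y} ->
    f = (-1) ^+ b0 * pfw (border B A) s ->
  exists (b : nat) e, [/\ leads (mwt (@varwt m)) e ((-1) ^+ b * f),
    forall v : var m, e (enum_rank v) <> 0%N -> possum v = (p + q).-1
    & exists i, e i <> 0%N].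
Proof.
move=> /andP[k0 kp] pq pqc sE ninl ->.
have [b [e [le _ ev ek]]] := pfg_leads K kp pq pqc sE ninl.
exists (b0 + b)%N, e; split; [|exact: ev|exact: ek].
by rewrite addnC exprD -mulrA signrMK.
Qed.

Lemma leads_pfA : exists (b : nat) e, [/\ leads (mwt (@varwt m)) e ((-1) ^+ b * pfA B A),
    forall v : var m, e (enum_rank v) <> 0%N -> possum v = (2 * c)%N
    & exists i, e i <> 0%N].
Proof.
have := @leads_of_word (map inr g) c c.+1 m (pfA B A) 0; rewrite mul1r.
have -> : (c + c.+1).-1 = (2 * c)%N by lia.
apply; rewrite ?m_gt0 //=; try by lia.
- by rewrite pos_enum subSnn addn2.
- by move=> x y /mapP[i _ ->] /mapP[j _ ->].
Qed.

Lemma inl_possum (x y : vertex) : both_inl x y ->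
  (pos x + pos y)%N != (2 * c).+1 /\ (pos x + pos y)%N != (2 * c).-1.
Proof.
case: x y => [k|i] [l|j] //= _; rewrite -mulnDl; move: (k + l)%N => a.
by case: a => [|[|[|a]]]; split; apply/eqP; nia.
Qed.

(** Moving the letter 2' to the middle sorts the word by position. *)
Lemma leads_pf01 : exists (b : nat) e, [/\ leads (mwt (@varwt m)) e ((-1) ^+ b * pf2 B A [:: 0; 1] g),
    forall v : var m, e (enum_rank v) <> 0%N -> possum v = (2 * c).-1
    & exists i, e i <> 0%N].
Proof.
have := @leads_of_word (inl 0 :: lowg ++ inl 1 :: highg) c c c
  (pf2 B A [:: 0; 1] g) (size lowg).
have -> : (c + c)%N = (2 * c)%N by lia.
apply=> //; try by lia.
- rewrite map_cons map_cat map_cons pos_lowg pos_highg subnn /= mul0n mul1n addn2.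
  by [].
- by move=> x y _ _ xy; apply/negP => /inl_possum[_]; rewrite xy eqxx.
- by rewrite /pf2 lowg_highg /= (alternating_move [:: inl 0] _ _ _ alt).
Qed.

(** Here 3' has to move to the end and then 2' to the middle. *)
Lemma leads_pf12 : exists (b : nat) e, [/\ leads (mwt (@varwt m)) e ((-1) ^+ b * pf2 B A [:: 1; 2] g),
    forall v : var m, e (enum_rank v) <> 0%N -> possum v = (2 * c).+1
    & exists i, e i <> 0%N].
Proof.
have := @leads_of_word (lowg ++ inl 1 :: highg ++ [:: inl 2]) c.+1 c.+1 c
  (pf2 B A [:: 1; 2] g) (size (lowg ++ highg) + size lowg).
have -> : (c.+1 + c.+1).-1 = (2 * c).+1 by lia.
apply=> //; try by lia.
- rewrite !map_cat map_cons map_cat pos_lowg pos_highg subSnn addn2.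
  have iotaS a : iota a c = iota a m ++ [:: (a + m)%N] by rewrite -[c]addn1 iotaD.
  rewrite !iotaS -catA; congr (_ ++ _ :: _ ++ [:: _]); rewrite /= !modn_small //; lia.
- by move=> x y _ _ xy; apply/negP => /inl_possum[+ _]; rewrite xy eqxx.
- rewrite /pf2 lowg_highg /= -[lowg ++ highg]cats0 (alternating_move [:: inl 1] _ _ _ alt) /= cats0.
  by rewrite exprD -mulrA -(alternating_move [::] _ _ _ alt) /= -catA.
Qed.

(** The signs normalise the leading coefficients to 1, so that the coefficient ring
    can be arbitrary. *)
Lemma regular_triple : exists b1 b2 b3 : nat,
  let f := nth 1 [:: (-1) ^+ b1 * pfA B A; (-1) ^+ b2 * pf2 B A [:: 0; 1] g;
                     (-1) ^+ b3 * pf2 B A [:: 1; 2] g] in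
  forall i p (d : nat -> gring K m), (i < 3)%N -> f i * p = \sum_(j < i) d j * f j ->
  exists b : nat -> gring K m, p = \sum_(j < i) b j * f j.
Proof.
have [b1 [e1 [l1 s1 n1]]] := leads_pfA.
have [b2 [e2 [l2 s2 n2]]] := leads_pf01.
have [b3 [e3 [l3 s3 n3]]] := leads_pf12.
exists b1, b2, b3 => f i p d; pose e := nth 0%MM [:: e1; e2; e3].
pose sums := nth 0%N [:: 2 * c; (2 * c).-1; (2 * c).+1]%N.
have eS j v : (j < 3)%N -> e j (enum_rank v) <> 0%N -> possum v = sums j.
  by case: j => [|[|[|]]] //= _; [apply: s1 | apply: s2 | apply: s3].
apply: (leads_regular (@mwtD _ (@varwt m)) (e := e)).
- by move=> [|[|[|]]].
- move=> i1 i2 k l1' l2' i12; case: (eqVneq (e i1 k) 0%N) => [->|/eqP E1]; first by left.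
  case: (eqVneq (e i2 k) 0%N) => [->|/eqP E2]; first by right.
  move: E1 E2; rewrite -(enum_valK k) => /(eS _ _ l1') E1 /(eS _ _ l2'); rewrite E1.
  case: i1 i2 l1' l2' i12 {E1} => [|[|[|]]] // [|[|[|]]] // _ _ _; rewrite /sums /=; lia.
- move=> [|[|[|j]]] //=; rewrite /e /f /= !nth_nil -mpolyX0; exact: leadsX.
Qed.

Local Notation d1 := (d1_of B A).
Local Notation d2 := (d2_of B A).
Local Notation d3 := (d3_of B A).

Lemma pfA_lreg : GRing.lreg (pfA B A).
Proof.
have [b1 [b2 [b3 reg]]] := regular_triple.
move=> x y xy; apply/eqP; rewrite -subr_eq0; apply/eqP.
have [|b ->] := reg 0%N (x - y) (fun=> 0) isT; last by rewrite big_ord0.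
by rewrite big_ord0 /= -mulrA mulrBr xy subrr mulr0.
Qed.

Lemma generic_exact : exact_at d1 d2 /\ exact_at d2 d3.
Proof.
have [b1 [b2 [b3 /= reg]]] := regular_triple.
have h1 := null_homotopicZ ((-1) ^+ b1) (null_homotopic_pfA B (@generic_AN K m) (@generic_A0 K m)).
have h2 := null_homotopicZ ((-1) ^+ b2) (null_homotopic_pair B (@generic_AN K m) (@generic_A0 K m) 2).
have h3 := null_homotopicZ ((-1) ^+ b3) (null_homotopic_pair B (@generic_AN K m) (@generic_A0 K m) 0).
have e2 : pairpf B A (2 + 1) (2 + 2) = pf2 B A [:: 0; 1] g.
  by rewrite mxE; congr (pf2 _ _ [:: _; _] _); apply: val_inj.
have e3 : pairpf B A (0 + 1) (0 + 2) = pf2 B A [:: 1; 2] g.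
  by rewrite mxE; congr (pf2 _ _ [:: _; _] _); apply: val_inj.
rewrite e2 in h2; rewrite e3 in h3.
set x1 := _ * _ in h1; set x2 := _ * _ in h2; set x3 := _ * _ in h3.
have reg1 a : x1 * a = 0 -> a = 0.
  by move=> xa; have [|b ->] := reg 0%N a (fun=> 0) isT; rewrite big_ord0.
have reg2 a b : x2 * a = x1 * b -> exists c, a = x1 * c.
  move=> xab; have [|d ->] := reg 1%N a (fun=> b) isT.
    by rewrite big_ord1 /= xab mulrC.
  by exists (d 0%N); rewrite big_ord1 mulrC.
have reg3 a b c : x3 * a = x1 * b + x2 * c -> exists d e, a = x1 * d + x2 * e.
  move=> xab; have [|d ->] := reg 2%N a (nth 0 [:: b; c]) isT.
    by rewrite !big_ord_recl big_ord0 addr0 /= xab mulrC [c * _]mulrC.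
  by exists (d 0%N), (d 1%N); rewrite !big_ord_recl big_ord0 addr0 mulrC [d 1%N * _]mulrC.
have d12 := mul_d1_d2 (@generic_AN K m) (@generic_A0 K m) pfA_lreg.
have d23 := mul_d2_d3 B (@generic_AN K m) (@generic_A0 K m).
have inj v := @d3_inj _ _ B A (@generic_AN K m) (@generic_A0 K m) v pfA_lreg.
split; first exact: (acyclic_exact1 reg1 reg2 reg3 d12 d23 inj h1 h2 h3).
exact: (acyclic_exact2 reg1 reg2 d23 inj h1 h2).
Qed.

(** The ideal is left open so that only its equality with the image of d1 matters,
    not the choice or order of its generators. *)
Lemma generic_resolution I :
    (forall x, x \in I -> exists v : 'cV_(3 + 1), x%:M = d1 *m v) ->
    (forall j, in_ideal I (d1 0 j)) ->
  free_resolution I d1 d2 d3.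
Proof.
move=> Id1 d1I; have [ex1 ex2] := generic_exact; split=> // [x|v]; last first.
  exact: (d3_inj (@generic_AN K m) (@generic_A0 K m) pfA_lreg).
rewrite cyclic_proj_eq0; split.
  have /choice[f fP] : forall i : 'I_(size I), exists v : 'cV_(3 + 1), (I`_i)%:M = d1 *m v.
    by move=> i; apply/Id1/mem_nth.
  move=> [a ->]; exists (\sum_i a i *: f i).
  rewrite mulmx_sumr raddf_sum; apply: eq_bigr => i _.
  by rewrite -scalemxAr -fP scale_scalar_mx.
move=> [v /matrixP/(_ 0 0)]; rewrite !mxE eqxx mulr1n => ->.
by apply: in_ideal_sum => j _; apply/in_idealMr/d1I.
Qed.

End GenericResolution.

(** * Deleted Pfaffians, exterior generators and ring morphisms *)

Lemma enum_ord_add m n :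
  enum 'I_(m + n) = map (@lshift m n) (enum 'I_m) ++ map (@rshift m n) (enum 'I_n).
Proof.
apply: (inj_map val_inj); rewrite map_cat val_enum_ord iotaD add0n.
rewrite -(map_comp val (@lshift m n)) -(map_comp val (@rshift m n)).
congr (_ ++ _); first by rewrite -val_enum_ord.
by rewrite -[in LHS](addn0 m) iotaDl -val_enum_ord -map_comp.
Qed.

Section DeletedPfaffians.
Variables (R : comNzRingType) (N : nat) (B : 'M[R]_(3, N)) (A : 'M[R]_N).

Lemma Pf_del_pf2 (l : seq nat) ps gs :
    [seq k : 'I_3 <- enum 'I_3 | k.+1 \notin l] = ps ->
    [seq j : 'I_N <- enum 'I_N | (j + 4)%N \notin l] = gs ->
  Pf_del (block_mx 0 B (- B^T) A) l = pf2 B A ps gs.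
Proof.
move=> <- <-; rewrite /Pf_del Pf_on_pfw.
have -> : enum [set i : 'I_(3 + N) | i.+1 \notin l] =
    map unsplit (map inl [seq k : 'I_3 <- enum 'I_3 | k.+1 \notin l] ++
                 map inr [seq j : 'I_N <- enum 'I_N | (j + 4)%N \notin l]).
  rewrite /enum_mem -enumT (eq_filter (a2 := fun i : 'I_(3 + N) => i.+1 \notin l)); last first.
    by move=> i; rewrite [LHS]inE.
  rewrite enum_ord_add filter_cat !filter_map map_cat -!map_comp; congr (_ ++ _).
  rewrite (eq_filter (a2 := fun j : 'I_N => (j + 4)%N \notin l)) // => j /=.
  by rewrite (addnC 3) addnS.
rewrite [LHS]pfw_map; apply: eq_pfw => -[k|i] [k'|i'] /=.
- by rewrite block_mxEul mxE.
- by rewrite block_mxEur.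
- by rewrite block_mxEdl !mxE.
- by rewrite block_mxEdr.
Qed.

End DeletedPfaffians.

Section PfaffianMorphism.
Variables (R S : comNzRingType) (f : {rmorphism R -> S}).

Lemma contract_rmorph (T : Type) (g : T -> R) (F : seq T -> R) s :
  f (contract g F s) = contract (f \o g) (f \o F) s.
Proof.
elim: s F => /= [|x s IH] F; first by rewrite rmorph0.
by rewrite rmorphB rmorphM IH.
Qed.

Lemma pfw_rmorph (T : Type) (a : T -> T -> R) s :
  f (pfw a s) = pfw (fun x y => f (a x y)) s.
Proof.
rewrite /pfw; move: (size s) => n; elim: n s => [|n IH] [|x s] /=; rewrite ?rmorph1 ?rmorph0 //.
by rewrite contract_rmorph; apply: eq_contract => u /=.
Qed.

Variables (N : nat) (B : 'M[R]_(3, N)) (A : 'M[R]_N).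

Lemma pf2_rmorph ps gs : f (pf2 B A ps gs) = pf2 (map_mx f B) (map_mx f A) ps gs.
Proof.
rewrite /pf2 pfw_rmorph; apply: eq_pfw => -[k|i] [l|j] /=; rewrite ?mxE ?rmorph0 ?rmorphN //.
Qed.

Lemma pairrow_rmorph : map_mx f (pairrow B A) = pairrow (map_mx f B) (map_mx f A).
Proof. by apply/matrixP => i j; rewrite !mxE pf2_rmorph. Qed.

Lemma d1_rmorph : map_mx f (d1_of B A) = d1_of (map_mx f B) (map_mx f A).
Proof.
by rewrite map_row_mx map_mxN pairrow_rmorph map_scalar_mx /= /pfA pf2_rmorph.
Qed.

Lemma d2_rmorph : map_mx f (d2_of B A) = d2_of (map_mx f B) (map_mx f A).
Proof.
rewrite map_block_mx pairrow_rmorph map_scalar_mx /= /pfA pf2_rmorph.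
by congr block_mx; apply/matrixP => i j; rewrite !mxE rmorphM rmorph_sign pf2_rmorph.
Qed.

Lemma d3_rmorph : map_mx f (d3_of B A) = d3_of (map_mx f B) (map_mx f A).
Proof. by rewrite map_col_mx. Qed.

End PfaffianMorphism.

Section IntegralComplex.
Variable m : nat.
Local Notation N := (2 * m)%N.
Local Notation A := (generic_A int m).
Local Notation B := (generic_B int m).
Local Notation g := (enum 'I_N).

Lemma filter_none (l : seq nat) : all (fun k => k <= 3)%N l ->
  [seq j : 'I_N <- g | (j + 4)%N \notin l] = g.
Proof.
move=> /allP l3; apply/all_filterP/allP => j _.
by apply/negP => /l3; lia.
Qed.

Lemma filter_one (l : seq nat) (j : 'I_N) : all (fun k => k <= 3)%N l ->
  [seq i : 'I_N <- g | (i + 4)%N \notin rcons l (j + 4)%N] = rem j g.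
Proof.
move=> /allP l3; rewrite rem_filter ?enum_uniq //; apply: eq_filter => i /=.
rewrite mem_rcons inE negb_or eqn_add2r -val_eqE /=; case: eqP => //= _.
by apply/negP => /l3; lia.
Qed.

Lemma ord3_cases (P : 'I_3 -> Prop) : P 0 -> P 1 -> P 2 -> forall i, P i.
Proof.
move=> P0 P1 P2 [[|[|[|]]]] // i.
- by rewrite (_ : Ordinal i = 0) //; apply: val_inj.
- by rewrite (_ : Ordinal i = 1) //; apply: val_inj.
- by rewrite (_ : Ordinal i = 2) //; apply: val_inj.
Qed.

Lemma pf_del0 : Pf_del (generic_U m) [:: 1; 2; 3]%N = pfA B A.
Proof. by apply: Pf_del_pf2; [rewrite enum_ord3 | apply: filter_none]. Qed.

(** The sign comes from sorting the cyclically ordered pair of border vertices. *)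
Lemma pf_del1 (i : 'I_3) :
  Pf_del (generic_U m) [:: i.+1] = (-1) ^+ i * pairrow B A 0 i.
Proof.
have pN := @pairpfN _ _ B A (@generic_AN int m) (@generic_A0 int m).
rewrite mxE; move: i; apply: ord3_cases.
- rewrite mul1r mxE; apply: Pf_del_pf2; last exact: filter_none.
  by rewrite enum_ord3 /=; congr [:: _; _]; apply: val_inj.
- rewrite expr1 mulN1r -pN mxE; apply: Pf_del_pf2; last exact: filter_none.
  by rewrite enum_ord3 /=; congr [:: _; _]; apply: val_inj.
- rewrite sqrrN expr1n mul1r mxE; apply: Pf_del_pf2; last exact: filter_none.
  by rewrite enum_ord3 /=; congr [:: _; _]; apply: val_inj.
Qed.

Lemma pf_del_single (i : 'I_3) (j : 'I_N) :
  Pf_del (generic_U m) (rcons (rem i.+1 [:: 1; 2; 3]%N) (j + 4)%N) = pf2 B A [:: i] (rem j g).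
Proof.
apply: Pf_del_pf2; last by apply: filter_one; move: i; apply: ord3_cases.
rewrite enum_ord3; have j4 : (4 <= j + 4)%N by lia.
move: (j + 4)%N j4 => k; move: i; apply: ord3_cases; case: k => [|[|[|[|k]]]] //.
Qed.

Lemma pf_del_triple (j : 'I_N) :
  Pf_del (generic_U m) [:: (j + 4)%N] = pf2 B A (enum 'I_3) (rem j g).
Proof.
apply: Pf_del_pf2; last exact: (@filter_one [::]).
by rewrite enum_ord3 !addnS.
Qed.

Lemma diff1E : diff1 m = d1_of B A.
Proof.
apply/matrixP => i j; rewrite ord1 {i} mxE /d1_of.
case: (split_ordP j) => k -> /=.
  rewrite row_mxEl [RHS]mxE; move: (pf_del1 k); move: k; apply: ord3_cases => /=.
  - by rewrite expr0 mul1r => ->.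
  - by rewrite expr1 mulN1r => ->.
  - by rewrite sqrrN expr1n mul1r => ->.
by rewrite row_mxEr ord1 mxE eqxx /= pf_del0.
Qed.

Lemma diff2E : diff2 m = d2_of B A.
Proof.
rewrite /diff2 pf_del0; congr block_mx; apply/matrixP => i j; rewrite [LHS]mxE.
- by rewrite pf_del_single [RHS]mxE.
- by rewrite pf_del1 signrMK ord1.
- by rewrite pf_del_triple [RHS]mxE.
Qed.

Lemma diff3E : diff3 m = d3_of B A. Proof. by []. Qed.

End IntegralComplex.

Section ExteriorGenerators.
Variables (R : comNzRingType) (N : nat) (B : 'M[R]_(3, N)) (A : 'M[R]_N).
Hypothesis AN : forall i j, A i j = - A j i.
Hypothesis A0 : forall i, A i i = 0.

Lemma sorted_enum_set (T : {set 'I_N}) : sorted (relpre val ltn) (enum T).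
Proof.
rewrite /enum_mem -enumT; apply: sorted_filter; first by move=> x y z /=; apply: ltn_trans.
by rewrite -sorted_map val_enum_ord iota_ltn_sorted.
Qed.

Lemma sorted_index (s : seq 'I_N) i : sorted (relpre val ltn) s -> i \in s ->
  index i s = count (fun p : 'I_N => p < i)%N s.
Proof.
have tr : transitive (relpre val ltn : rel 'I_N) by move=> x y z /=; apply: ltn_trans.
elim: s => // x s IH /=; rewrite path_sortedE // => /andP[/allP xs ss]; rewrite inE.
case: eqVneq => [ix _|ix /= ins]; last by have /= xi := xs _ ins; rewrite IH // xi.
rewrite -{1}ix ltnn; apply/esym/eqP; rewrite add0n -leqn0 leqNgt -has_count.
by apply/hasPn => y /xs /=; rewrite -ix; lia.
Qed.

(** The elements of T are i, those above it and those below it. *)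
Lemma inversions_set1 (T : {set 'I_N}) i : i \in T ->
  (inversions (T :\ i) [set i] + index i (enum T)).+1 = #|T|.
Proof.
move=> iT; rewrite sorted_index ?sorted_enum_set ?mem_enum //.
have -> : inversions (T :\ i) [set i] = count (fun p : 'I_N => i < p)%N (enum T).
  have uf : uniq [seq p : 'I_N <- enum T | (i < p)%N] by apply/filter_uniq/enum_uniq.
  rewrite /inversions -size_filter -(card_uniqP uf).
  rewrite -(card_imset _ (f := fun p : 'I_N => (p, i))); last by move=> p q [].
  apply: eq_card => -[p q]; rewrite !inE; apply/idP/imsetP => [|[p' + [-> ->]]].
    rewrite /= => /and3P[/andP[pi pT] /eqP -> ip]; exists p => //.
    by rewrite mem_filter ip mem_enum.
  by rewrite mem_filter mem_enum eqxx => /andP[ip ->]; rewrite ip andbT neq_ltn ip orbT.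
rewrite cardE -(count_predC (pred1 i)) count_uniq_mem ?enum_uniq // mem_enum iT add1n.
congr _.+1; rewrite -count_predUI [X in (_ + X)%N](_ : _ = 0%N) ?addn0; last first.
  by rewrite (eq_count (a2 := pred0)) ?count_pred0 // => p /=; lia.
by apply: eq_count => p /=; rewrite -val_eqE /= neq_ltn orbC.
Qed.

(** Wedging with a vector on the right is a contraction, up to the sign of moving
    the vector from the right end to the left end. *)
Lemma wedge_vector (x : ext R N) (f : seq 'I_N -> R) (T : {set 'I_N}) k :
    (forall i, i \in T -> x (T :\ i) = f (enum (T :\ i))) ->
  wedge x (ext_u B k) T = (-1) ^+ #|T|.-1 * contract (B k) f (enum T).
Proof.
move=> xf; rewrite ffunE.
transitivity (\sum_(i in T) (-1) ^+ inversions (T :\ i) [set i] * x (T :\ i) * B k i).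
  under eq_bigr do rewrite ffunE mulr_sumr.
  rewrite (exchange_big_dep predT) //= [in RHS]big_mkcond /=; apply: eq_bigr => i _.
  have [iT|iT] := boolP (i \in T); last first.
    apply: big_pred0 => S; apply/negP => /andP[_ /eqP e].
    by move/negP: iT; apply; have := set11 i; rewrite -e inE => /andP[].
  rewrite (big_pred1 (T :\ i)) => [|S /=].
    by rewrite setDDr setDv set0U (setIidPr _) ?sub1set.
  apply/andP/eqP => [[ST /eqP e]|->].
    by rewrite -e setDDr setDv set0U (setIidPr ST).
  by rewrite subsetDl setDDr setDv set0U (setIidPr _) ?sub1set.
rewrite contract_uniq ?enum_uniq // big_enum mulr_sumr /=.
apply: eq_bigr => i iT; rewrite xf //.
have -> : enum (T :\ i) = rem i (enum T).
  rewrite rem_filter ?enum_uniq // /enum_mem -filter_predI; apply: eq_filter => j.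
  by rewrite /= !inE.
rewrite -(inversions_set1 iT) /= exprD -!mulrA; congr (_ * _).
by rewrite mulrCA [B k i * _]mulrC signrMK mulrC.
Qed.

Lemma ext_top_C j : N = (2 * j)%N -> ext_top (ext_C A j) = pfA B A.
Proof.
move=> /eqP Nj; rewrite /ext_top ffunE cardsT card_ord Nj Pf_on_pfw /pfA /pf2 /= pfw_map.
by rewrite enum_setT -enumT.
Qed.

(** Both sides are the double contraction of the Pfaffian by the rows k and l,
    taken in opposite orders. *)
Lemma ext_top_C_u_u j k l : N = (2 * j.+1)%N ->
  ext_top (wedge (wedge (ext_C A j) (ext_u B k)) (ext_u B l)) = - pf2 B A [:: k; l] (enum 'I_N).
Proof.
move=> Nj; have cT : #|[set: 'I_N]| = (2 * j).+2 by rewrite cardsT card_ord Nj; lia.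
rewrite /ext_top (wedge_vector (f := contract (B k) (pfw A))) => [|i _]; last first.
  have ci : #|[set: 'I_N] :\ i| = (2 * j).+1.
    by have := cardsD1 i [set: 'I_N]; rewrite cT inE; lia.
  rewrite (wedge_vector (f := pfw A)) => [|i' i'T]; last first.
    rewrite ffunE; have := cardsD1 i' ([set: 'I_N] :\ i); rewrite ci i'T add1n => -[<-].
    by rewrite eqxx Pf_on_pfw.
  by rewrite ci /= exprM sqrrN expr1n expr1n mul1r.
rewrite cT /= exprS exprM sqrrN expr1n expr1n mulr1 mulN1r contractC opprK enum_setT -enumT.
have := @pfw_border_cons _ _ B A; rewrite /pf2 /= => _.
rewrite pfw_cons /= mul0r sub0r opprK contract_map; apply: eq_contract => u /=.
rewrite pfw_cons contract_map; apply: eq_contract => v /=.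
by rewrite pfw_map.
Qed.

End ExteriorGenerators.

(** * The bigrading *)

Section Grading.
Variables (K : comNzRingType) (m : nat).
Local Notation N := (2 * m)%N.
Local Notation A := (generic_A K m).
Local Notation B := (generic_B K m).

Lemma bideg_monE (mu : 'X_{1..#|var m|}) :
  bideg_mon mu = ((mwt (fun v => is_inl v) mu)%:Z, (mwt (fun v => ~~ is_inl v) mu)%:Z).
Proof.
rewrite /bideg_mon; congr (Posz _, Posz _); rewrite /mwt [RHS]big_sumType /=.
  rewrite [X in (_ + X)%N]big1 ?addn0 => [|v _]; last by rewrite muln0.
  by apply: eq_bigr => v _; rewrite muln1.
rewrite [X in (X + _)%N]big1 ?add0n => [|v _]; last by rewrite muln0.
by apply: eq_bigr => v _; rewrite muln1.
Qed.

Lemma mwt_lin w w' (a b : nat) (mu : 'X_{1..#|var m|}) :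
  mwt (fun v => a * w v + b * w' v)%N mu = (a * mwt w mu + b * mwt w' mu)%N.
Proof.
rewrite /mwt !big_distrr -big_split /=; apply: eq_bigr => v _; lia.
Qed.

(** Twice the c-degree plus the u-degree counts inner vertices, and the u-degree
    counts border vertices, as each edge does.  The degrees are integers because
    the last block of d2 vanishes, with a negative formal degree, when m = 1. *)
Lemma pf2_bihomogeneous ps gs (d : int * int) :
    d.2 = (size ps)%:Z -> 2 * d.1 + d.2 = (size gs)%:Z ->
  bihomogeneous d (pf2 B A ps gs).
Proof.
case: d => d1 d2 /= -> ed mu mus; rewrite bideg_monE.
pose al1 (x : 'I_3 + 'I_N) : nat := ~~ is_inl x.
pose al2 (x : 'I_3 + 'I_N) : nat := is_inl x.
have sum1 : (\sum_(x <- map inl ps ++ map inr gs) al1 x = size gs)%N.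
  rewrite big_cat !big_map /= big1 // add0n /al1 /=.
  by rewrite sum1_size.
have sum2 : (\sum_(x <- map inl ps ++ map inr gs) al2 x = size ps)%N.
  rewrite big_cat !big_map /= [X in (_ + X)%N]big1 // addn0 /al2 /=.
  by rewrite sum1_size.
have h2 : mwt (fun v : var m => ~~ is_inl v) mu = size ps.
  rewrite -sum2; apply: (pfg_homogeneous (K := K)) mus => -[p|[k i]] //.
have h1 : mwt (fun v : var m => 2 * is_inl v + 1 * ~~ is_inl v)%N mu = size gs.
  rewrite -sum1; apply: (pfg_homogeneous (K := K)) mus => -[p|[k i]] //.
move: h1; rewrite mwt_lin h2 => h1.
by congr (_, _); lia.
Qed.

Lemma bihomogeneous_sign d (b : nat) (p : gring K m) :
  bihomogeneous d p -> bihomogeneous d ((-1) ^+ b * p).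
Proof. by move=> dp mu; rewrite msupp_signM; apply: dp. Qed.

Lemma bihomogeneousN d (p : gring K m) : bihomogeneous d p -> bihomogeneous d (- p).
Proof. by move/(bihomogeneous_sign (b := 1)); rewrite mulN1r. Qed.

Lemma bihomogeneous0 d : bihomogeneous (m := m) d (0 : gring K m).
Proof. by move=> mu; rewrite msupp0. Qed.

Lemma bihomogeneous_gvar (v : var m) :
  bihomogeneous (m := m) (Posz (is_inl v), Posz (~~ is_inl v)) (gvar K v).
Proof. by move=> mu; rewrite msuppX inE => /eqP ->; rewrite bideg_monE !mwt_var. Qed.

Definition vars_gens : seq (gring K m) := [seq gvar K v | v <- enum (var m)].

Lemma in_vars_coef0 (p : gring K m) : in_ideal vars_gens p -> p@_0%MM = 0.
Proof.
case=> a ->; rewrite raddf_sum big1 // => i _ /=.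
have /mapP[v _ ->] := mem_nth 0 (ltn_ord i : (i < size vars_gens)%N).
apply: memN_msupp_eq0; apply/negP => /msuppM_le/allpairsP[[m1 m2] /= [_]].
rewrite msuppX inE => /eqP -> /eqP; rewrite eq_sym mnmD_eq0 => /andP[_].
by rewrite mnm1_eq0.
Qed.

(** Only the constant monomial has bidegree (0, 0). *)
Lemma bihomogeneous_in_vars d (p : gring K m) :
  d != (0, 0) -> bihomogeneous d p -> in_ideal vars_gens p.
Proof.
move=> d0 dp; rewrite [p]mpolyE big_seq; apply: in_ideal_sum => mu mup.
have mu0 : mu != 0%MM.
  apply: contraNneq d0 => mu0; rewrite -(dp _ mup) mu0 bideg_monE /mwt.
  by rewrite !big1 // => v _; rewrite mnm0E.
have [i mui] : exists i, mu i != 0%N.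
  apply/existsP; apply: contraNT mu0 => /existsPn H; apply/eqP/mnmP => i.
  by rewrite mnm0E; apply/eqP; move: (H i); rewrite negbK.
rewrite -(submK (m := U_(i)%MM) (m' := mu)) ?lep1mP // mpolyXD -mul_mpolyC mulrA.
apply: in_idealMl; apply: in_ideal_mem; apply/mapP; exists (enum_val i); first by rewrite mem_enum.
by rewrite /gvar enum_valK.
Qed.

End Grading.

Section Bases.
Variable m : nat.
Local Notation N := (2 * m)%N.

Lemma card_ext_basis n j : #|ext_basis n j| = 'C(n, j).
Proof.
by rewrite card_sig -[in RHS](card_ord n) -card_draws; apply: eq_card => S; rewrite !inE.
Qed.

Definition ext_full n : ext_basis n n.
Proof. by exists [set: 'I_n]; rewrite cardsT card_ord. Defined.

Definition ext_omit n (i : 'I_n) : ext_basis n n.-1.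
Proof. by exists [set~ i]; rewrite cardsC1 card_ord. Defined.

Lemma ext_omit_inj n : injective (@ext_omit n).
Proof. by move=> i j /(congr1 val) /= /setC_inj/set1_inj. Qed.

Definition basis0 (i : 'I_1) : gbasis free0 := tt.

Definition basis1 (i : 'I_(3 + 1)) : gbasis (free1 m) :=
  match split i with
  | inl k => inr (ext_full N, ext_omit k)
  | inr _ => inl (ext_full N)
  end.

Definition basis2 (i : 'I_(3 + N)) : gbasis (free2 m) :=
  match split i with
  | inl k => inl ((ext_full N, ext_full N), ext_omit k)
  | inr j => inr ((ext_full N, ext_omit j), ext_full 3)
  end.

Definition basis3 (i : 'I_N) : gbasis (free3 m) :=
  ((i, (ext_full N, ext_full N)), ext_full 3).

Lemma basis0_bij : bijective basis0.
Proof.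
by apply: inj_card_bij => [i j _|]; rewrite ?(ord1 i) ?(ord1 j) // card_unit card_ord.
Qed.

Lemma basis1_bij : bijective basis1.
Proof.
apply: inj_card_bij => [i j|]; last first.
  by rewrite card_sum card_prod !card_ext_basis card_ord !binn.
rewrite /basis1; case: splitP => k ik; case: splitP => l jl // e; apply: val_inj.
  by rewrite /= ik jl (@ext_omit_inj 3 k l) //; case: e => e; apply: val_inj.
by rewrite /= ik jl !ord1.
Qed.

Lemma basis2_bij : (0 < m)%N -> bijective basis2.
Proof.
move=> m0; apply: inj_card_bij => [i j|]; last first.
  have N0 : (0 < N)%N by lia.
  have cN : 'C(N, N.-1) = N by rewrite -[X in 'C(X, _)](prednK N0) binSn prednK.
  by rewrite card_sum !card_prod !card_ext_basis card_ord !binn cN !mul1n muln1.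
rewrite /basis2; case: splitP => k ik; case: splitP => l jl // e; apply: val_inj.
  by rewrite /= ik jl (@ext_omit_inj 3 k l) //; case: e => e; apply: val_inj.
by rewrite /= ik jl (@ext_omit_inj N k l) //; case: e => e; apply: val_inj.
Qed.

Lemma basis3_bij : bijective basis3.
Proof.
apply: inj_card_bij => [i j [] //|].
by rewrite !card_prod !card_ext_basis card_ord !binn !muln1.
Qed.

End Bases.

(** * Minimality, grade and perfection *)

Section Assembly.
Variables (K : comNzRingType) (m : nat).
Hypothesis m_gt0 : (0 < m)%N.
Local Notation N := (2 * m)%N.
Local Notation A := (generic_A K m).
Local Notation B := (generic_B K m).
Local Notation g := (enum 'I_N).
Local Notation AN := (@generic_AN K m).
Local Notation A0 := (@generic_A0 K m).
Local Notation d1 := (d1_of B A).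
Local Notation d2 := (d2_of B A).
Local Notation d3 := (d3_of B A).

(** The Pfaffian form of the exterior generators, in the same order. *)
Definition pf_gens : seq (gring K m) :=
  [:: pfA B A; - pf2 B A [:: 0; 1] g; - pf2 B A [:: 0; 2] g; - pf2 B A [:: 1; 2] g].

Lemma pairrowE : [/\ pairrow B A 0 0 = pf2 B A [:: 1; 2] g,
  pairrow B A 0 1 = - pf2 B A [:: 0; 2] g & pairrow B A 0 2 = pf2 B A [:: 0; 1] g].
Proof.
have pN := @pairpfN _ _ B A AN A0; split; rewrite mxE.
- by rewrite mxE; congr (pf2 _ _ [:: _; _] _); apply: val_inj.
- by rewrite pN mxE; congr (- pf2 _ _ [:: _; _] _); apply: val_inj.
- by rewrite mxE; congr (pf2 _ _ [:: _; _] _); apply: val_inj.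
Qed.

Lemma d1_entries : [/\ d1 0 (lshift 1 0) = - pf2 B A [:: 1; 2] g,
  d1 0 (lshift 1 1) = pf2 B A [:: 0; 2] g, d1 0 (lshift 1 2) = - pf2 B A [:: 0; 1] g
  & d1 0 (rshift 3 0) = pfA B A].
Proof.
have [e0 e1 e2] := pairrowE; split; rewrite ?row_mxEl ?row_mxEr mxE ?e0 ?e1 ?e2 ?opprK //.
Qed.

Lemma d1_delta x j b : x = (-1) ^+ b * d1 0 j -> exists v : 'cV_(3 + 1), x%:M = d1 *m v.
Proof.
move=> ->; exists ((-1) ^+ b *: delta_mx j 0); rewrite -scalemxAr -colE.
by apply/matrixP => k l; rewrite !ord1 !mxE eqxx mulr1n.
Qed.

Lemma pf_gens_resolution : free_resolution pf_gens d1 d2 d3.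
Proof.
have [e0 e1 e2 e3] := d1_entries.
apply: generic_resolution => // [x|j].
  rewrite !inE => /or4P[] /eqP ->.
  - by apply: (d1_delta (j := rshift 3 0) (b := 0)); rewrite mul1r e3.
  - by apply: (d1_delta (j := lshift 1 2) (b := 0)); rewrite mul1r e2.
  - by apply: (d1_delta (j := lshift 1 1) (b := 1)); rewrite mulN1r e1.
  - by apply: (d1_delta (j := lshift 1 0) (b := 0)); rewrite mul1r e0.
case: (split_ordP j) => k ->; last first.
  by rewrite ord1 e3; apply: in_ideal_mem; rewrite !inE eqxx.
move: k; apply: ord3_cases.
- by rewrite e0; apply: in_ideal_mem; rewrite !inE eqxx !orbT.
- rewrite e1 -[pf2 _ _ _ _]opprK -mulN1r; apply/in_idealMl/in_ideal_mem.
  by rewrite !inE eqxx !orbT.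
- by rewrite e2; apply: in_ideal_mem; rewrite !inE eqxx !orbT.
Qed.

Lemma graded_map1 : graded_map (m := m) (@basis0) (@basis1 m) d1.
Proof.
move=> i j; rewrite ord1 {i} /basis1 -[gdeg (basis0 0)]/(- 0, - 0).
case: (splitP j) => k jk.
  have {jk} -> : j = lshift 1 k by apply: val_inj.
  rewrite row_mxEl mxE !mxE; apply: bihomogeneousN; apply: pf2_bihomogeneous => /=.
    by [].
  by rewrite size_enum_ord; lia.
have {jk} -> : j = rshift 3 k by apply: val_inj.
rewrite row_mxEr mxE ord1 eqxx; apply: pf2_bihomogeneous => /=.
  by [].
by rewrite size_enum_ord; lia.
Qed.

Lemma size_rem_enum (j : 'I_N) : size (rem j g) = N.-1.
Proof. by rewrite size_rem ?mem_enum // size_enum_ord. Qed.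

Lemma graded_map2 : graded_map (m := m) (@basis1 m) (@basis2 m) d2.
Proof.
move=> i j; rewrite /basis1 /basis2.
case: (splitP i) => k ik; case: (splitP j) => l jl.
- have -> : i = lshift 1 k by apply: val_inj.
  have -> : j = lshift N l by apply: val_inj.
  rewrite block_mxEul mxE; case: eqP => _; last exact: bihomogeneous0.
  by apply: pf2_bihomogeneous; rewrite /= ?size_enum_ord; lia.
- have -> : i = lshift 1 k by apply: val_inj.
  have -> : j = rshift 3 l by apply: val_inj.
  rewrite block_mxEur mxE; apply: bihomogeneous_sign.
  by apply: pf2_bihomogeneous; rewrite /= ?size_rem_enum; lia.
- have -> : i = rshift 3 k by apply: val_inj.
  have -> : j = lshift N l by apply: val_inj.
  rewrite block_mxEdl !mxE.
  by apply: pf2_bihomogeneous; rewrite /= ?size_enum_ord; lia.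
- have -> : i = rshift 3 k by apply: val_inj.
  have -> : j = rshift 3 l by apply: val_inj.
  rewrite block_mxEdr mxE; apply: bihomogeneous_sign.
  by apply: pf2_bihomogeneous; rewrite /= ?size_enum_ord ?size_rem_enum; lia.
Qed.

Lemma graded_map3 : graded_map (m := m) (@basis2 m) (@basis3 m) d3.
Proof.
move=> i j; rewrite /basis2; case: (splitP i) => k ik.
  have -> : i = lshift N k by apply: val_inj.
  rewrite col_mxEu mxE => mu mus; rewrite (bihomogeneous_gvar mus) /=.
  by congr (_, _); rewrite /=; lia.
have -> : i = rshift 3 k by apply: val_inj.
rewrite col_mxEd => mu /(@msupp_border _ _ (inr k) (inr j)) [v -> ev].
rewrite (@bihomogeneous_gvar K m v); last by rewrite msuppX inE.
have -> : is_inl v by case: v ev => [p|[? ?]] // [].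
by congr (_, _); rewrite /=; lia.
Qed.

Lemma graded_minimal p q (M M' : gfree) (e : 'I_p -> gbasis M) (f : 'I_q -> gbasis M')
    (d : 'M[gring K m]_(p, q)) :
    graded_map e f d -> (forall i j, gdeg (f j) - gdeg (e i) != 0) ->
  minimal_map d.
Proof. by move=> gr ne i j; apply: (bihomogeneous_in_vars (ne i j) (gr i j)). Qed.

Lemma minimal_d1 : minimal_map d1.
Proof.
apply: (graded_minimal graded_map1) => i j; rewrite /basis1 ord1.
by case: splitP => k _; rewrite -pair_eqE /pair_eq /=; lia.
Qed.

Lemma minimal_d2 : minimal_map d2.
Proof.
apply: (graded_minimal graded_map2) => i j; rewrite /basis1 /basis2.
by case: splitP => k _; case: splitP => l _; rewrite -pair_eqE /pair_eq /=; lia.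
Qed.

Lemma minimal_d3 : minimal_map d3.
Proof.
apply: (graded_minimal graded_map3) => i j; rewrite /basis2.
by case: splitP => l _; rewrite -pair_eqE /pair_eq /=; lia.
Qed.

Lemma graded_resolution :
  minimal_graded_free_resolution pf_gens (@basis0) (@basis1 m) (@basis2 m) (@basis3 m) d1 d2 d3.
Proof.
split; last by split; [exact: minimal_d1 | exact: minimal_d2 | exact: minimal_d3].
- by split; [exact: basis0_bij | exact: basis1_bij | exact: basis2_bij | exact: basis3_bij].
- by split; [exact: graded_map1 | exact: graded_map2 | exact: graded_map3].
- exact: pf_gens_resolution.
Qed.

Lemma one_notin_vars : ~ in_ideal (vars_gens K m) 1.
Proof. by move/in_vars_coef0/eqP; rewrite mcoeff1 eqxx oner_eq0. Qed.

Lemma d3_not_split (h : 'M_(N, 3 + N)) : h *m d3 <> 1%:M.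
Proof.
move=> hd; have i : 'I_N by apply: (@Ordinal _ 0); lia.
have := @mx_inMl _ (vars_gens K m) _ _ _ h _ minimal_d3 i i.
by rewrite hd mxE eqxx; apply: one_notin_vars.
Qed.

Lemma pf_gens_in_vars x : x \in pf_gens -> in_ideal (vars_gens K m) x.
Proof.
move=> xI; have [v e] : exists v : 'cV_(3 + 1), x%:M = d1 *m v.
  by apply/(resolution_in_ideal pf_gens_resolution)/in_ideal_mem.
have := mx_inMr v minimal_d1 (0 : 'I_1) (0 : 'I_1).
by rewrite -e mxE eqxx.
Qed.

Lemma pf_gens_regular : exists s, regular_sequence_in pf_gens s /\ size s = 3.
Proof.
have [b1 [b2 [b3]]] := regular_triple K m_gt0; set f := nth 1 _ => /= reg.
have fI i : (i < 3)%N -> in_ideal pf_gens (f i).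
  case: i => [|[|[|]]] //= _; apply: in_idealMl.
  - by apply: in_ideal_mem; rewrite !inE eqxx.
  - rewrite -[pf2 _ _ _ _]opprK -mulN1r; apply/in_idealMl/in_ideal_mem.
    by rewrite !inE eqxx !orbT.
  - rewrite -[pf2 _ _ _ _]opprK -mulN1r; apply/in_idealMl/in_ideal_mem.
    by rewrite !inE eqxx !orbT.
have sI x : x \in mkseq f 3 -> in_ideal pf_gens x.
  by case/mapP => i; rewrite mem_iota => /andP[_ i3] ->; apply: fI.
exists (mkseq f 3); split; last by rewrite size_mkseq.
split=> //; split=> [i|one].
  rewrite size_mkseq => i3 x.
  have -> : take i (mkseq f 3) = mkseq f i.
    by rewrite /mkseq -map_take take_iota (minn_idPl (ltnW i3)).
  rewrite nth_mkseq // => /in_ideal_mkseq[a e]; apply/in_ideal_mkseq.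
  exact: (reg i x a i3 e).
apply: one_notin_vars; apply: in_ideal_trans one => x /sI.
exact/in_ideal_trans/pf_gens_in_vars.
Qed.

Lemma pf_gens_perfect : perfect_of_grade pf_gens 3.
Proof.
have res := pf_gens_resolution; split; split.
- exact: pf_gens_regular.
- by move=> s sI; apply: (regular_sequence_size res sI) => h; apply: d3_not_split.
- exact: resolution_projective_dimension_le res.
- by move=> d pd; apply: (resolution_projective_dimension_ge res pd) => h; apply: d3_not_split.
Qed.

End Assembly.

Lemma ideal_gensE m : (0 < m)%N -> ideal_gens m = pf_gens int m.
Proof.
move=> m0; have Nm : (2 * m = 2 * m.-1.+1)%N by rewrite prednK.
have i1 : inord 0 = 0 :> 'I_3 by apply: val_inj; rewrite /= inordK.
have i2 : inord 1 = 1 :> 'I_3 by apply: val_inj; rewrite /= inordK.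
have i3 : inord 2 = 2 :> 'I_3 by apply: val_inj; rewrite /= inordK.
have uu k l := ext_top_C_u_u (generic_B int m) (generic_A int m) k l Nm.
have eC := ext_top_C (generic_B int m) (generic_A int m) (erefl (2 * m)%N).
pose w (k l : 'I_3) := ext_top (wedge (wedge (ext_C (generic_A int m) m.-1)
  (ext_u (generic_B int m) k)) (ext_u (generic_B int m) l)).
have -> : ideal_gens m = [:: ext_top (ext_C (generic_A int m) m); w (inord 0) (inord 1);
  w (inord 0) (inord 2); w (inord 1) (inord 2)] by [].
have wE k l : w k l = - pf2 (generic_B int m) (generic_A int m) [:: k; l] (enum 'I_(2 * m)).
  exact: uu.
by rewrite eC !wE i1 i2 i3.
Qed.

Section BaseChange.
Variables (K : comNzRingType) (m : nat).

Definition base_change_rmorph : {rmorphism gring int m -> gring K m} :=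
  map_mpoly (intr : {rmorphism int -> K}).

Lemma base_change_gvar v : base_change_rmorph (gvar int v) = gvar K v.
Proof. exact: map_mpolyX. Qed.

Lemma map_generic_B : map_mx base_change_rmorph (generic_B int m) = generic_B K m.
Proof. by apply/matrixP => k i; rewrite !mxE base_change_gvar. Qed.

Lemma map_generic_A : map_mx base_change_rmorph (generic_A int m) = generic_A K m.
Proof.
apply/matrixP => i j; rewrite !mxE.
case: insubP => [p _ _|_]; first by rewrite base_change_gvar.
case: insubP => [p _ _|_]; last by rewrite rmorph0.
by rewrite rmorphN base_change_gvar.
Qed.

Lemma map_pf_gens : map base_change_rmorph (pf_gens int m) = pf_gens K m.
Proof.
by rewrite /pf_gens /pfA /= !rmorphN !pf2_rmorph map_generic_A map_generic_B.
Qed.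

End BaseChange.

Theorem proposition3p2 (m : nat) (hm : (1 <= m)%N) :
  exists (e0 : 'I_1 -> gbasis free0)
         (e1 : 'I_(3 + 1) -> gbasis (free1 m))
         (e2 : 'I_(3 + 2 * m) -> gbasis (free2 m))
         (e3 : 'I_(2 * m) -> gbasis (free3 m)),
    [/\ forall i, is_inl (e1 i) = (3 <= i)%N,
        forall i, is_inl (e2 i) = (i < 3)%N,
        minimal_graded_free_resolution (ideal_gens m) e0 e1 e2 e3
          (diff1 m) (diff2 m) (diff3 m)
      & forall k : fieldType,
          let Ik := [seq base_change k x | x <- ideal_gens m] in
          minimal_graded_free_resolution Ik e0 e1 e2 e3
            (map_mx (base_change k (m := m)) (diff1 m))
            (map_mx (base_change k (m := m)) (diff2 m))
            (map_mx (base_change k (m := m)) (diff3 m)) /\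
          perfect_of_grade Ik 3].
Proof.
exists basis0, (@basis1 m), (@basis2 m), (@basis3 m); split.
- by move=> i; rewrite /basis1; case: splitP => k ->; rewrite ?leq_addr // leqNgt ltn_ord.
- by move=> i; rewrite /basis2; case: splitP.
- rewrite ideal_gensE // diff1E diff2E diff3E; exact: graded_resolution.
move=> k Ik.
have -> : Ik = pf_gens k m by rewrite /Ik ideal_gensE // -(map_pf_gens k m); apply: eq_map.
rewrite diff1E diff2E diff3E -[base_change k (m := m)]/(base_change_rmorph k m : _ -> _).
rewrite d1_rmorph d2_rmorph d3_rmorph map_generic_A map_generic_B.
split; [exact: graded_resolution | exact: pf_gens_perfect].
Qed.
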